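(* For every nonnegative integer $n$, \begin{align*} \mathrm{OSOME}(24n+19)&\equiv0\pmod3,\\ \mathrm{OSOME}(40n+27)&\equiv0\pmod5,\\ \mathrm{OSOME}(8n+7)&\equiv0\pmod8,\\ \mathrm{OSOME}(88n+55)&\equiv0\pmod{11}. \end{align*}
   Context: An overpartition of a nonnegative integer $n$ is a partition of $n$ (a non-increasing sequence of positive integers with sum $n$) in which the first occurrence of each number may be overlined (or not). $\mathrm{OSOME}_o(n)$ (resp. $\mathrm{OSOME}_e(n)$) denotes the sum of all odd (resp. even) overlined parts, taken over all overpartitions of $n$, and $\mathrm{OSOME}(n):=\mathrm{OSOME}_o(n)-\mathrm{OSOME}_e(n)$. *)

(* Defs.v *)
From mathcomp Require Import all_boot all_order all_algebra.

Set Implicit Arguments.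
Unset Strict Implicit.
Unset Printing Implicit Defensive.

(* A part of an overpartition is a pair (value, overlined?). *)
Definition is_overpartition (n : nat) (s : seq (nat * bool)) : bool :=
  let parts := unzip1 s in
  [&& sorted geq parts,
      all (fun k => 0 < k) parts,
      sumn parts == n
    & [forall i : 'I_(size s),
        (nth (0, false) s i).2 ==> (index (nth 0 parts i) parts == i)]].

(* The overpartitions of n have at most n parts, each of them at most n, so they
   are all represented in the finite type n.-bseq ('I_n.+1 * bool), exactly once:
   see overpartition_decode and decode_inj. *)
Definition decode (n : nat) (t : n.-bseq ('I_n.+1 * bool)) : seq (nat * bool) :=
  [seq (nat_of_ord p.1, p.2) | p <- t].

Definition OSOME_o (n : nat) : nat :=
  \sum_(t : n.-bseq ('I_n.+1 * bool) | is_overpartition n (decode t))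
    \sum_(p <- decode t | p.2 && odd p.1) p.1.

Definition OSOME_e (n : nat) : nat :=
  \sum_(t : n.-bseq ('I_n.+1 * bool) | is_overpartition n (decode t))
    \sum_(p <- decode t | p.2 && ~~ odd p.1) p.1.

Definition OSOME (n : nat) : int := ((OSOME_o n)%:Z - (OSOME_e n)%:Z)%R.

Lemma decode_inj (n : nat) : injective (@decode n).
Proof.
move=> t u /inj_map tu; apply/val_inj/tu => -[i a] [j b] /= [ij ->].
by congr (_, _); apply: val_inj.
Qed.

Lemma overpartition_decode (n : nat) (s : seq (nat * bool)) :
  is_overpartition n s -> exists t : n.-bseq ('I_n.+1 * bool), decode t = s.
Proof.
case/and4P=> _ pos /eqP sum_s _.
have size_le : size s <= n.
  rewrite -sum_s; elim: s pos {sum_s} => //= p s IHs /andP[p_gt0 /IHs].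
  by move=> le_s; rewrite -addn1 addnC leq_add.
have part_le p : p \in s -> p.1 <= n.
  move=> ps; have: p.1 \in unzip1 s by apply: map_f.
  rewrite -sum_s; elim: (unzip1 s) => //= k r IHr; rewrite inE.
  by case/predU1P=> [->|/IHr le_r]; rewrite ?leq_addr ?(leq_trans le_r) ?leq_addl.
pose f (p : nat * bool) : 'I_n.+1 * bool := (inord p.1, p.2).
have size_f : size (map f s) <= n by rewrite size_map.
exists (Bseq size_f); rewrite /decode /= -map_comp -[RHS]map_id.
by apply/eq_in_map => -[k b] ps /=; rewrite inordK // ltnS (part_le _ ps).
Qed.

(* Main.v *)
Require Import Defs.
From mathcomp Require Import all_boot all_order all_algebra.
From HB Require Import structures.
From mathcomp Require Import boolp.
From mathcomp Require Import ring zify.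

(** Let phi(q) = sum_(n in Z) q^(n^2) and psi(q) = sum_(n >= 0) q^(n(n+1)/2).
    Overpartitions are generated by prod_k (1 + q^k) / (1 - q^k), which is
    1 / phi(-q), and the parts k that carry an overline contribute
    (-1)^(k+1) k q^k / (1 + q^k) to the signed sum.  Hence the generating
    series W of OSOME is 1 / phi(-q) times the logarithmic derivative, for
    theta = q d/dq, of prod_(k odd) (1 + q^k) / prod_(k even) (1 + q^k)
    ([OSOME_log_derivative]).  That quotient is a square root of
    phi(q) / psi(q^2), and Jacobi's four-square theorem in
    the form [four_squares] evaluates its logarithmic derivative as
    (1 - phi(-q)^4) / 8.  So 8 W = 1 / phi(-q) - phi(-q)^3
    ([OSOME_four_squares]).  The product formulas for phi and psi come from the
    triple product identity, the four-square theorem from Jacobi's series for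
    f^3, where f = prod_k (1 - q^k), by rotating the index lattice of f^3 f^3.

    Splitting phi into even and odd powers of q three times isolates the
    exponents 8n+3 and 8n+7:

      sum_n W(8n+7) q^n = 8 psi(q)^7 / phi(-q)^8,
      sum_n W(8n+3) q^n = psi(q)^3 ((a + b) / c^2 + 1),

    with a = phi(q)^4, b = 16 q psi(q^2)^4 and c = phi(-q)^4 = a - b.  The
    congruence modulo 8 is visible.  For a prime p, a series over the field with
    p elements that theta kills has only exponents divisible by p, so it acts
    as a constant: multiplying by it, or cancelling it, does not mix exponent
    classes modulo p.  All p-th powers are of this kind.

    Modulo 11 the first series is such a constant times 1 / f, that is, times
    the generating series of partitions, and what is needed is Ramanujan's
    congruence p(11n+6) = 0.  With J = f^3 one has 1 / f = J^7 / f^22.  Jacobi's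
    series confines the exponents of J to five classes modulo 11, the
    pentagonal number theorem confines those of J^4 = f f^11 to six classes,
    and the resulting five quartic relations between the parts of J force the
    class 6 of J^7 to vanish ([seventh_power_mod11]).

    Modulo 3 and 5, the four-square theorem and c = a - b say that a, b, c
    satisfy a differential system in which only the logarithmic derivative of a
    is unknown.  As phi has only square exponents, theta^2 phi = theta phi modulo 3
    and theta^3 phi = theta phi modulo 5, and likewise for phi(-q).  Modulo 3
    this forces a + b = 1 ([ode_mod3]), so the second series is a constant
    times phi(-q) plus a constant, and 2 is not a square modulo 3.  Modulo 5 it
    gives a Riccati equation; comparing it at q and q^2 through
    phi(q) phi(-q) = phi(-q^2)^2 yields a^2 - ab + b^2 = 1
    ([quadric_mod5]).  Then q times the second series is, up to a constant
    factor, 1 - c^2 + theta(c^-2), while u = c^2 + c^-2 satisfies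
    theta^2 u + u = 2 ([oscillator_mod5]): an exponent n = 4 modulo 5 has
    n^2 + 1 = 2, so it does not occur in u, nor in the series. *)

Set Implicit Arguments.
Unset Strict Implicit.
Unset Printing Implicit Defensive.
Import Order.TTheory GRing.Theory Num.Theory.
Local Open Scope ring_scope.

(** * Formal power series in q *)

Definition series (R : comNzRingType) := nat -> R.

Section SeriesRing.
Variable R : comNzRingType.
Implicit Types f g h : series R.

HB.instance Definition _ := gen_eqMixin (series R).
HB.instance Definition _ := gen_choiceMixin (series R).

Definition series_const (x : R) : series R := fun n => if n is 0 then x else 0.
Definition series_add f g : series R := fun n => f n + g n.
Definition series_opp f : series R := fun n => - f n.
Definition series_mul f g : series R :=
  fun n => \sum_(i < n.+1) f i * g (n - i)%N.

Lemma serP f g : (forall n, f n = g n) -> f = g.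
Proof. exact: functional_extensionality_dep. Qed.

Definition trunc (N : nat) f : {poly R} := \poly_(i < N) f i.

Lemma coef_trunc N f n : (n < N)%N -> (trunc N f)`_n = f n.
Proof. by move=> lt_nN; rewrite coef_poly lt_nN. Qed.

Lemma series_mul_trunc N f g n :
  (n < N)%N -> series_mul f g n = (trunc N f * trunc N g)`_n.
Proof.
move=> ltnN; rewrite coefM; apply: eq_bigr => i _.
by rewrite !coef_trunc //; have := ltn_ord i; lia.
Qed.

(** Coefficients below N of a product depend only on those of the factors;
    this transports the ring laws from polynomials to series. *)
Lemma coefM_eq (p q p' q' : {poly R}) N :
    (forall n, (n < N)%N -> p`_n = p'`_n) ->
    (forall n, (n < N)%N -> q`_n = q'`_n) ->
  forall n, (n < N)%N -> (p * q)`_n = (p' * q')`_n.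
Proof.
move=> eqp eqq n ltnN; rewrite !coefM; apply: eq_bigr => i _.
by rewrite eqp ?eqq //; have := ltn_ord i; lia.
Qed.

Lemma trunc_mul N f g n :
  (n < N)%N -> (trunc N (series_mul f g))`_n = (trunc N f * trunc N g)`_n.
Proof. by move=> ltnN; rewrite coef_trunc // (series_mul_trunc _ _ ltnN). Qed.

Fact series_addA : associative series_add.
Proof. by move=> f g h; apply: serP => n; apply: addrA. Qed.
Fact series_addC : commutative series_add.
Proof. by move=> f g; apply: serP => n; apply: addrC. Qed.
Fact series_add0 : left_id (series_const 0) series_add.
Proof. by move=> f; apply: serP => -[|n]; apply: add0r. Qed.
Fact series_addN : left_inverse (series_const 0) series_opp series_add.
Proof. by move=> f; apply: serP => -[|n]; apply: addNr. Qed.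

HB.instance Definition _ := GRing.isZmodule.Build (series R)
  series_addA series_addC series_add0 series_addN.

Fact series_mulC : commutative series_mul.
Proof.
move=> f g; apply: serP => n.
by rewrite !(series_mul_trunc _ _ (ltnSn n)) mulrC.
Qed.

Fact series_mulA : associative series_mul.
Proof.
move=> f g h; apply: serP => n.
rewrite !(series_mul_trunc _ _ (ltnSn n)).
rewrite (@coefM_eq _ _ (trunc n.+1 f) (trunc n.+1 g * trunc n.+1 h) n.+1) //; last first.
  by move=> m; apply: trunc_mul.
rewrite (@coefM_eq (trunc n.+1 (series_mul f g)) _
           (trunc n.+1 f * trunc n.+1 g) (trunc n.+1 h) n.+1) ?mulrA //.
by move=> m; apply: trunc_mul.
Qed.

Fact series_mul1 : left_id (series_const 1) series_mul.
Proof.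
move=> f; apply: serP => n.
rewrite /series_mul big_ord_recl /= mul1r subn0 big1 ?addr0 // => i _.
by rewrite mul0r.
Qed.

Fact series_mulDl : left_distributive series_mul series_add.
Proof.
move=> f g h; apply: serP => n; rewrite /series_add /series_mul -big_split.
by apply: eq_bigr => i _; rewrite mulrDl.
Qed.

Fact series_1neq0 : series_const 1 != 0.
Proof. by apply/eqP => /(congr1 (fun f => f 0%N)) /eqP; rewrite oner_eq0. Qed.

HB.instance Definition _ := GRing.Zmodule_isComNzRing.Build (series R)
  series_mulA series_mulC series_mul1 series_mulDl series_1neq0.

Lemma coef0 n : (0 : series R) n = 0. Proof. by case: n. Qed.
Lemma coef1 n : (1 : series R) n = (n == 0%N)%:R. Proof. by case: n. Qed.
Lemma coefD f g n : (f + g) n = f n + g n. Proof. by []. Qed.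
Lemma coefN f n : (- f) n = - f n. Proof. by []. Qed.
Lemma coefB f g n : (f - g) n = f n - g n. Proof. by []. Qed.
Lemma coefE f g n : (f * g) n = \sum_(i < n.+1) f i * g (n - i)%N.
Proof. by []. Qed.
Lemma coef_mul_trunc N f g n :
  (n < N)%N -> (f * g) n = (trunc N f * trunc N g)`_n.
Proof. exact: series_mul_trunc. Qed.
Lemma coef_mul0 f g : (f * g) 0%N = f 0%N * g 0%N.
Proof. by rewrite coefE big_ord_recl big_ord0 addr0. Qed.
Lemma coefMn f k n : (f *+ k) n = f n *+ k.
Proof. by elim: k => [|k IHk]; rewrite ?mulr0n ?coef0 // !mulrS coefD IHk. Qed.
Lemma coef_sum I (r : seq I) (P : pred I) (F : I -> series R) n :
  (\sum_(i <- r | P i) F i) n = \sum_(i <- r | P i) F i n.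
Proof.
by apply: (big_ind2 (fun f x => f n = x)) => [|f x g y <- <-|]; rewrite ?coef0.
Qed.

Definition mon (x : R) (k : nat) : series R := fun n => if n == k then x else 0.

Lemma coef_monM x k f n :
  (mon x k * f) n = if (k <= n)%N then x * f (n - k)%N else 0.
Proof.
rewrite coefE; case: leqP => [le_kn | lt_nk]; last first.
  by rewrite big1 // => i _; rewrite /mon ltn_eqF ?mul0r //; have := ltn_ord i; lia.
have ltk : (k < n.+1)%N by [].
rewrite (bigD1 (Ordinal ltk)) //= /mon eqxx big1 ?addr0 // => i.
by rewrite -val_eqE /= => /negPf ->; rewrite mul0r.
Qed.

Lemma mon_mul x y j k : mon x j * mon y k = mon (x * y) (j + k).
Proof.
apply: serP => n; rewrite coef_monM /mon; case: leqP => [le_jn | lt_nj].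
  by rewrite -(eqn_add2r j) subnK // addnC; case: eqP; rewrite ?mulr0.
by case: eqP => // e; lia.
Qed.

Local Notation qX := (mon 1).

Lemma mon0 : qX 0 = 1. Proof. by apply: serP => -[|n]. Qed.

Lemma monX x k n : mon x k ^+ n = mon (x ^+ n) (k * n).
Proof.
elim: n => [|n IHn]; first by rewrite muln0 mon0.
by rewrite !exprS IHn mon_mul mulnS.
Qed.

Lemma mon_inj k f g : qX k * f = qX k * g -> f = g.
Proof.
move=> e; apply: serP => n; have /(congr1 (fun h => h (n + k)%N)) := e.
by rewrite !coef_monM leq_addl addnK !mul1r.
Qed.

(** The first n+1 coefficients of the inverse of a series with constant term
    1, obtained by solving f * g = 1 degree by degree. *)
Fixpoint inv_seq f (n : nat) : seq R :=
  if n is m.+1 then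
    let s := inv_seq f m in
    rcons s (- \sum_(i < m.+1) f i.+1 * s`_(m - i))
  else [:: 1].

Definition sinv f : series R := fun n => (inv_seq f n)`_n.

Lemma size_inv_seq f n : size (inv_seq f n) = n.+1.
Proof. by elim: n => //= n IHn; rewrite size_rcons IHn. Qed.

Lemma nth_inv_seq f n k : (k <= n)%N -> (inv_seq f n)`_k = sinv f k.
Proof.
elim: n => [|n IHn]; first by case: k.
rewrite leq_eqVlt => /predU1P[-> // | lt_kn] /=.
by rewrite nth_rcons size_inv_seq lt_kn IHn.
Qed.

Lemma mul_sinv f : f 0%N = 1 -> f * sinv f = 1.
Proof.
move=> f0; apply: serP => -[|n]; first by rewrite coef_mul0 f0 mul1r.
rewrite coefE big_ord_recl f0 mul1r subn0 {1}/sinv /= nth_rcons size_inv_seq.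
rewrite ltnn eqxx addrC coef1 [RHS]/=; apply/eqP.
rewrite subr_eq0; apply/eqP/eq_bigr => i _; rewrite /bump /= add1n subSS.
by rewrite nth_inv_seq // leq_subr.
Qed.

Lemma series_mulI f g h : f 0%N = 1 -> f * g = f * h -> g = h.
Proof.
move=> /mul_sinv fV /(congr1 (fun k => sinv f * k)).
by rewrite !mulrA ![sinv f * f]mulrC fV !mul1r.
Qed.

Lemma coef0X f n : f 0%N = 1 -> (f ^+ n) 0%N = 1.
Proof. by move=> f0; elim: n => // n IHn; rewrite exprS coef_mul0 f0 IHn mulr1. Qed.

Lemma coef0M f g : f 0%N = 1 -> g 0%N = 1 -> (f * g) 0%N = 1.
Proof. by move=> f0 g0; rewrite coef_mul0 f0 g0 mulr1. Qed.

(** The operator q d/dq. *)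
Definition theta f : series R := fun n => f n *+ n.

Lemma theta_is_additive : zmod_morphism theta.
Proof. by move=> f g; apply: serP => n; rewrite /theta !coefB mulrnBl. Qed.

HB.instance Definition _ :=
  GRing.isZmodMorphism.Build (series R) (series R) theta theta_is_additive.

Lemma thetaD f g : theta (f + g) = theta f + theta g.
Proof. exact: raddfD. Qed.
Lemma thetaB f g : theta (f - g) = theta f - theta g.
Proof. exact: raddfB. Qed.
Lemma thetaN f : theta (- f) = - theta f.
Proof. exact: raddfN. Qed.

Lemma thetaM f g : theta (f * g) = theta f * g + f * theta g.
Proof.
apply: serP => n; rewrite /theta coefD !coefE -sumrMnl -big_split /=.
apply: eq_bigr => i _; rewrite mulrnAl mulrnAr -mulrnDr.
by rewrite subnKC // -ltnS.
Qed.

Lemma theta1 : theta 1 = 0.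
Proof. by apply: serP => -[|n]; rewrite /theta ?mulr0n // coef1 mul0rn. Qed.

Lemma thetaMn f k : theta (f *+ k) = theta f *+ k.
Proof. exact: raddfMn. Qed.

Lemma theta_nat k : theta k%:R = 0.
Proof. by rewrite raddfMn /= theta1 mul0rn. Qed.

Lemma thetaX f n : theta (f ^+ n) = n%:R * f ^+ n.-1 * theta f.
Proof.
elim: n => [|[|n] IHn]; first by rewrite theta1 !mul0r.
  by rewrite expr1 expr0 !mul1r.
by rewrite exprS thetaM IHn /= exprS -[n.+2%:R]natr1; ring.
Qed.

Lemma theta_mon x k : theta (mon x k) = k%:R * mon x k.
Proof.
apply: serP => n; rewrite mulr_natl coefMn /theta /mon.
by case: eqP => [-> | _]; rewrite ?mul0rn.
Qed.

(** The series f(q^d). *)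
Definition sub (d : nat) f : series R :=
  fun n => if (d %| n)%N then f (n %/ d)%N else 0.

Lemma sub_is_additive d : zmod_morphism (sub d).
Proof.
move=> f g; apply: serP => n; rewrite [RHS]coefB /sub coefB.
by case: ifP => // _; rewrite subr0.
Qed.

HB.instance Definition _ d :=
  GRing.isZmodMorphism.Build (series R) (series R) (sub d) (sub_is_additive d).

Lemma subD d f g : sub d (f + g) = sub d f + sub d g.
Proof. exact: raddfD. Qed.
Lemma subB d f g : sub d (f - g) = sub d f - sub d g.
Proof. exact: raddfB. Qed.

Lemma sub1 d : (0 < d)%N -> sub d 1 = 1.
Proof.
move=> d0; apply: serP => n; rewrite /sub !coef1; case: ifP => [/dvdnP[k ->]|].
  by rewrite mulnK // muln_eq0 (gtn_eqF d0) orbF.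
by case: n => //; rewrite dvdn0.
Qed.

Lemma coef_sub_comp d f N n : (0 < d)%N -> (n < N)%N ->
  sub d f n = (trunc N f \Po 'X^d)`_n.
Proof.
move=> d0 ltnN; rewrite coef_comp_poly_Xn // /sub; case: ifP => // _.
by rewrite coef_trunc // (leq_ltn_trans (leq_div _ _)).
Qed.

Lemma subM d f g : (0 < d)%N -> sub d (f * g) = sub d f * sub d g.
Proof.
move=> d0; apply: serP => n; have ltn := ltnSn n.
rewrite (coef_mul_trunc _ _ ltn) (coef_sub_comp _ d0 ltn).
rewrite (@coefM_eq (trunc n.+1 (sub d f)) (trunc n.+1 (sub d g))
   (trunc n.+1 f \Po 'X^d) (trunc n.+1 g \Po 'X^d) n.+1); first last.
- by [].
- by move=> m ltm; rewrite coef_trunc // (coef_sub_comp _ d0 ltm).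
- by move=> m ltm; rewrite coef_trunc // (coef_sub_comp _ d0 ltm).
rewrite -comp_polyM !coef_comp_poly_Xn //; case: ifP => // _.
have lt1 : (n %/ d < n.+1)%N by rewrite ltnS leq_div.
by rewrite coef_trunc // (coef_mul_trunc _ _ lt1).
Qed.

Lemma subX d f n : (0 < d)%N -> sub d (f ^+ n) = sub d f ^+ n.
Proof.
by move=> d0; elim: n => [|n IHn]; rewrite ?sub1 // !exprS subM // IHn.
Qed.

Lemma sub_mon d x k : (0 < d)%N -> sub d (mon x k) = mon x (d * k).
Proof.
move=> d0; apply: serP => n; rewrite /sub /mon; case: ifP => [/dvdnP[j ->]|].
  by rewrite mulnK // mulnC eqn_pmul2l.
by case: eqP => // -> /negP[]; apply: dvdn_mulr.
Qed.

Lemma sub_sub d e f : (0 < d)%N -> (0 < e)%N -> sub d (sub e f) = sub (d * e) f.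
Proof.
move=> d0 e0; apply: serP => n; rewrite /sub; case: ifP => [/dvdnP[k ->]|].
  by rewrite mulnK // [(k * d)%N]mulnC dvdn_pmul2l // divnMl.
by case: ifP => // /(dvdn_trans (dvdn_mulr e (dvdnn d))) ->.
Qed.

Lemma sub_nat d k : (0 < d)%N -> sub d k%:R = k%:R.
Proof. by move=> d0; rewrite raddfMn /= sub1. Qed.

Lemma theta_sub d f : (0 < d)%N -> theta (sub d f) = sub d (theta f) *+ d.
Proof.
move=> d0; apply: serP => n; rewrite coefMn /theta /sub; case: ifP => [/dvdnP[k ->]|].
  by rewrite mulnK // mulrnA.
by rewrite !mul0rn.
Qed.

Lemma coef0_sub d f : sub d f 0%N = f 0%N.
Proof. by rewrite /sub dvdn0 div0n. Qed.

Definition sec (d j : nat) f : series R := fun n => f (d * n + j)%N.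

Lemma sec_is_additive d j : zmod_morphism (sec d j).
Proof. by move=> f g; apply: serP. Qed.

HB.instance Definition _ d j :=
  GRing.isZmodMorphism.Build (series R) (series R) (sec d j) (sec_is_additive d j).

Lemma secD d j f g : sec d j (f + g) = sec d j f + sec d j g.
Proof. exact: raddfD. Qed.

(** A series in q^d acts as a scalar on the exponents in a fixed class modulo
    d; this is what makes it possible to extract such a class from a
    product. *)
Lemma sec_subM d j f g : (j < d)%N -> sec d j (sub d f * g) = f * sec d j g.
Proof.
move=> ltjd; have d0 : (0 < d)%N by lia.
apply: serP => n; rewrite /sec !coefE.
transitivity (\sum_(0 <= i < (d * n + j).+1 | (d %| i)%N)
                f (i %/ d)%N * g (d * n + j - i)%N).
  rewrite big_mkord [RHS]big_mkcond; apply: eq_bigr => i _; rewrite /sub.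
  by case: ifP; rewrite ?mul0r.
rewrite -[RHS](big_mkord xpredT (fun i => f i * g (d * (n - i) + j)%N)).
rewrite -[LHS]big_filter.
have -> : [seq i <- index_iota 0 (d * n + j).+1 | (d %| i)%N]
        = [seq (d * k)%N | k <- index_iota 0 n.+1].
  apply: (irr_sorted_eq ltn_trans ltnn).
  - exact/(sorted_filter ltn_trans)/iota_ltn_sorted.
  - rewrite sorted_map; apply: sub_sorted (iota_ltn_sorted _ _) => x y /=.
    by rewrite ltn_mul2l d0.
  move=> i; rewrite mem_filter mem_index_iota leq0n andTb.
  apply/idP/mapP => [/andP[/dvdnP[k ->] lt]|[k]].
    exists k; last by rewrite mulnC.
    by rewrite mem_index_iota /=; nia.
  by rewrite mem_index_iota /= => lt ->; rewrite dvdn_mulr //=; nia.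
rewrite big_map; apply: eq_big_nat => k /andP[_ ltk].
by rewrite mulKn //; congr (_ * g _); nia.
Qed.

Lemma sec_sub d j f : (j < d)%N -> sec d j (sub d f) = f * sec d j 1.
Proof. by move=> ltjd; rewrite -[sub d f]mulr1 sec_subM. Qed.

Lemma sec_mon d j k : (j < d)%N -> (k < d)%N ->
  sec d j (mon 1 k) = (j == k)%:R.
Proof.
move=> ltj ltk; apply: serP => n; rewrite /sec /mon.
have -> : ((d * n + j)%N == k) = (n == 0%N) && (j == k).
  apply/eqP/andP=> [e|[/eqP-> /eqP->]]; last by rewrite muln0.
  have n0 : n = 0%N by nia.
  by move: e; rewrite n0 muln0 => /eqP; split.
case: (j == k); rewrite ?andbT ?andbF ?mulr0n ?mulr1n ?coef0 ?coef1 //.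
by case: (n == 0%N).
Qed.

End SeriesRing.

Local Notation qX := (mon 1).

Lemma series_intMI (k : nat) (f g : series int) :
  (0 < k)%N -> f *+ k = g *+ k -> f = g.
Proof.
move=> k0 e; apply: serP => n; have /(congr1 (fun h => h n)) := e.
by rewrite !coefMn; apply: pmulrnI.
Qed.

(** * Infinite products and sums of monomials *)

Section Agree.
Variable R : comNzRingType.
Implicit Types f g h : series R.

(** Congruence modulo q^N. Infinite products and sums are handled through
    their finite approximations modulo every power of q. *)
Definition agree (N : nat) f g := forall n, (n < N)%N -> f n = g n.

Lemma agree_eq f g : (forall N, agree N f g) -> f = g.
Proof. by move=> e; apply: serP => n; apply: (e n.+1). Qed.

Lemma agree_sym N f g : agree N f g -> agree N g f.
Proof. by move=> e n lt; rewrite e. Qed.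

Lemma agree_trans N f g h : agree N f g -> agree N g h -> agree N f h.
Proof. by move=> e e' n lt; rewrite e ?e'. Qed.

Lemma agree_leq M N f g : (N <= M)%N -> agree M f g -> agree N f g.
Proof. by move=> le e n lt; apply: e; apply: leq_trans le. Qed.

Lemma agree_add N f g f' g' :
  agree N f f' -> agree N g g' -> agree N (f + g) (f' + g').
Proof. by move=> ef eg n lt; rewrite !coefD ef ?eg. Qed.

Lemma agree_opp N f f' : agree N f f' -> agree N (- f) (- f').
Proof. by move=> ef n lt; rewrite !coefN ef. Qed.

Lemma agree_mul N f g f' g' :
  agree N f f' -> agree N g g' -> agree N (f * g) (f' * g').
Proof.
move=> ef eg n lt; rewrite !coefE; apply: eq_bigr => i _.
by rewrite ef ?eg //; have := ltn_ord i; lia.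
Qed.

Lemma agree_sum N I (r : seq I) (P : pred I) (F G : I -> series R) :
  (forall i, P i -> agree N (F i) (G i)) ->
  agree N (\sum_(i <- r | P i) F i) (\sum_(i <- r | P i) G i).
Proof.
move=> e; apply: (big_ind2 (agree N)) => // f f' g g'; exact: agree_add.
Qed.

Lemma agree_monM N M x k f g :
  (M <= N + k)%N -> agree N f g -> agree M (mon x k * f) (mon x k * g).
Proof.
by move=> le e n lt; rewrite !coef_monM; case: leqP => // lek; rewrite e //; lia.
Qed.

Lemma agree_mul1 N f x k : (N <= k)%N -> agree N (f * (1 + mon x k)) f.
Proof.
move=> le n lt; rewrite mulrDr mulr1 coefD mulrC coef_monM leqNgt.
by rewrite (leq_trans lt le) addr0.
Qed.

Lemma agree_theta N f g : agree N f g -> agree N (theta f) (theta g).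
Proof. by move=> e n lt; rewrite /theta e. Qed.

Lemma agree_sub N d f g : (0 < d)%N -> agree N f g -> agree N (sub d f) (sub d g).
Proof.
move=> d0 e n lt; rewrite /sub; case: ifP => // _.
by rewrite e // (leq_ltn_trans (leq_div _ _)).
Qed.

Lemma agree_mulI N f g h : f 0%N = 1 -> agree N (f * g) (f * h) -> agree N g h.
Proof.
move=> f0 e; have V := mul_sinv f0.
have -> : g = sinv f * (f * g) by rewrite mulrA [sinv f * f]mulrC V mul1r.
have -> : h = sinv f * (f * h) by rewrite mulrA [sinv f * f]mulrC V mul1r.
exact: agree_mul.
Qed.

Definition qprodn (e : R) (c r m : nat) : series R :=
  \prod_(0 <= k < m) (1 + mon e (c * k + r)).

(** The product of 1 + e q^(c k + r) over all k >= 0. Its n-th coefficient is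
    read off from the first n+1 factors, since the later ones do not touch it
    when c > 0. *)
Definition qprod (e : R) (c r : nat) : series R := fun n => qprodn e c r n.+1 n.

Lemma qprodnS e c r m :
  qprodn e c r m.+1 = qprodn e c r m * (1 + mon e (c * m + r)).
Proof. by rewrite /qprodn big_nat_recr. Qed.

Lemma agree_qprodn e c r m M : (0 < c)%N -> (m <= M)%N ->
  agree m (qprodn e c r M) (qprodn e c r m).
Proof.
move=> c0; elim: M => [|M IHM]; first by rewrite leqn0 => /eqP->.
rewrite leq_eqVlt => /predU1P[-> //|le]; rewrite qprodnS.
by apply: agree_trans (IHM le); apply: agree_mul1; nia.
Qed.

Lemma agree_qprod e c r m M : (0 < c)%N -> (m <= M)%N ->
  agree m (qprodn e c r M) (qprod e c r).
Proof.
move=> c0 le n lt; rewrite /qprod; apply: (agree_qprodn e r c0 _ (ltnSn n)).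
exact: leq_trans le.
Qed.

Lemma qprod_eq e c r f : (0 < c)%N ->
  (forall m, agree m (qprodn e c r m) f) -> qprod e c r = f.
Proof.
move=> c0 e'; apply: agree_eq => m.
by apply: agree_trans (e' m); apply/agree_sym/agree_qprod.
Qed.

Lemma qprod0 e c r : (0 < c)%N -> (0 < r)%N -> qprod e c r 0%N = 1.
Proof.
move=> c0 r0; rewrite /qprod /qprodn big_nat1 coefD coef1 /mon.
by rewrite (ltn_eqF (_ : 0 < c * 0 + r)%N) ?addr0 // muln0.
Qed.

Lemma sub_qprod d e c r : (0 < d)%N -> (0 < c)%N ->
  sub d (qprod e c r) = qprod e (d * c) (d * r).
Proof.
move=> d0 c0; apply/esym/qprod_eq => [|m]; first by rewrite muln_gt0 d0.
have -> : qprodn e (d * c) (d * r) m = sub d (qprodn e c r m).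
  elim: m => [|m IHm]; first by rewrite /qprodn !big_nil sub1.
  rewrite !qprodnS subM // IHm raddfD /= sub1 // sub_mon //.
  by rewrite mulnDr mulnA.
by apply: agree_sub => //; apply: agree_qprod.
Qed.

Lemma qprod_split d e : (0 < d)%N -> qprod e 1 1 = \prod_(r < d) qprod e d r.+1.
Proof.
move=> d0; apply: agree_eq => m.
have le_m : (m <= m * d)%N by nia.
apply: agree_trans (agree_sym (agree_qprod e 1 (ltn0Sn 0) le_m)) _.
have -> : qprodn e 1 1 (m * d) = \prod_(r < d) qprodn e d r.+1 m.
  elim: m {le_m} => [|m IHm].
    by rewrite mul0n /qprodn big_nil big1 // => i _; rewrite big_nil.
  rewrite /qprodn mulSn addnC (@big_cat_nat _ _ _ (m * d)) ?leq_addr //=.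
  rewrite -/(qprodn e 1 1 (m * d)) IHm -{1}[(m * d)%N]add0n big_addn addKn.
  rewrite big_mkord -big_split /=.
  apply: eq_bigr => i _; rewrite -!/(qprodn _ _ _ _) qprodnS.
  congr (_ * (1 + mon e _)).
  by rewrite mul1n addn1 addnS mulnC addnC.
apply: (big_ind2 (agree m)) => // [f f' g g' |i _]; first exact: agree_mul.
exact: agree_qprod.
Qed.

(** The sum of w(t) q^(e(t)) over all t >= 0, for exponents with e(t) >= t -
    1: then only t < n + 2 can contribute to the n-th coefficient. The slack
    of 1 admits the exponents t(t-1)/2, which vanish at both t = 0 and t =
    1. *)
Definition qsum (w : nat -> R) (e : nat -> nat) : series R :=
  fun n => \sum_(0 <= t < n.+2 | e t == n) w t.

Lemma coef_sum_mon M (w : nat -> R) (e : nat -> nat) n :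
  (\sum_(0 <= t < M) mon (w t) (e t) : series R) n = \sum_(0 <= t < M | e t == n) w t.
Proof.
rewrite coef_sum [RHS]big_mkcond; apply: eq_bigr => t _.
by rewrite /mon eq_sym.
Qed.

Lemma agree_qsum M (w : nat -> R) (e : nat -> nat) : (forall t, t <= (e t).+1)%N ->
  agree M.-1 (\sum_(0 <= t < M) mon (w t) (e t)) (qsum w e).
Proof.
move=> le n lt; rewrite coef_sum_mon /qsum.
have leM : (n.+2 <= M)%N by lia.
rewrite (@big_cat_nat _ _ _ n.+2) //= [X in _ + X]big_nat_cond.
rewrite [X in _ + X]big1 ?addr0 // => t /andP[/andP[ltt _] /eqP et].
by have := le t; lia.
Qed.

Lemma qsum_agree (w : nat -> R) (e : nat -> nat) f :
    (forall t, t <= (e t).+1)%N ->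
    (forall M, agree M.-1 (\sum_(0 <= t < M) mon (w t) (e t)) f) ->
  qsum w e = f.
Proof.
move=> le h; apply: agree_eq => N.
exact: agree_trans (agree_sym (agree_qsum (M := N.+1) w le)) (h N.+1).
Qed.

Lemma eq_qsum (w w' : nat -> R) (e e' : nat -> nat) :
  w =1 w' -> e =1 e' -> qsum w e = qsum w' e'.
Proof.
move=> ew ee; apply: serP => n; rewrite /qsum.
by under eq_bigl do rewrite ee; under eq_bigr do rewrite ew.
Qed.

Lemma qsum_shift (w : nat -> R) (e : nat -> nat) :
    (forall t, t <= (e t).+1)%N ->
  qsum w e = mon (w 0%N) (e 0%N) + qsum (fun t => w t.+1) (fun t => e t.+1).
Proof.
move=> le; apply: serP => n; rewrite coefD /qsum big_mkcond big_nat_recl //=.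
congr (_ + _); first by rewrite /mon eq_sym.
rewrite [RHS]big_mkcond [RHS]big_nat_recr //=.
by case: eqP => [en|]; rewrite ?addr0 //; have := le n.+2; lia.
Qed.

Lemma qsum_parity (w : nat -> R) (e : nat -> nat) :
    (forall t, t <= (e t).+1)%N ->
  qsum w e = qsum (fun t => w (2 * t)%N) (fun t => e (2 * t)%N)
           + qsum (fun t => w (2 * t).+1) (fun t => e (2 * t).+1).
Proof.
move=> le; apply: agree_eq => N.
have lee t : (t <= (e (2 * t)%N).+1)%N by have := le (2 * t)%N; lia.
have leo t : (t <= (e (2 * t).+1).+1)%N by have := le (2 * t).+1; lia.
have leN : (N <= (2 * N.+1).-1)%N by lia.
apply: agree_trans (agree_sym (agree_leq leN (agree_qsum w le))) _.
have -> : \sum_(0 <= t < 2 * N.+1) mon (w t) (e t)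
   = \sum_(0 <= t < N.+1) mon (w (2 * t)%N) (e (2 * t)%N)
     + \sum_(0 <= t < N.+1) mon (w (2 * t).+1) (e (2 * t).+1).
  elim: N.+1 => [|M IHM]; first by rewrite muln0 !big_nil addr0.
  rewrite mulnS !addSn add0n !big_nat_recr //= IHM.
  by rewrite -!addrA; congr (_ + _); rewrite addrCA.
by apply: agree_add; apply: (agree_qsum (M := N.+1)).
Qed.

Lemma sub_qsum d (w : nat -> R) (e : nat -> nat) :
    (0 < d)%N -> (forall t, t <= (e t).+1)%N ->
  sub d (qsum w e) = qsum w (fun t => d * e t)%N.
Proof.
move=> d0 le; apply/esym/qsum_agree => [t|M]; first by have := le t; nia.
have -> : \sum_(0 <= t < M) mon (w t) (d * e t)
        = sub d (\sum_(0 <= t < M) mon (w t) (e t)).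
  by rewrite raddf_sum; apply: eq_bigr => t _; rewrite /= sub_mon.
exact/agree_sub/agree_qsum.
Qed.

Lemma mon_qsum x k (w : nat -> R) (e : nat -> nat) :
    (forall t, t <= (e t).+1)%N ->
  mon x k * qsum w e = qsum (fun t => x * w t) (fun t => k + e t)%N.
Proof.
move=> le; apply/esym/qsum_agree => [t|M]; first by have := le t; lia.
under eq_bigr do rewrite -mon_mul.
by rewrite -mulr_sumr; apply: agree_mul => //; apply: agree_qsum.
Qed.

Lemma theta_qsum (w : nat -> R) (e : nat -> nat) :
  theta (qsum w e) = qsum (fun t => w t *+ e t) e.
Proof.
apply: serP => n; rewrite /theta /qsum -sumrMnl.
by apply: eq_bigr => t /eqP ->.
Qed.

Lemma qsum_coef M (w : nat -> R) (e : nat -> nat) n :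
    (forall t, t <= (e t).+1)%N -> (n.+2 <= M)%N ->
  qsum w e n = \sum_(0 <= t < M | e t == n) w t.
Proof.
move=> le lt; rewrite -coef_sum_mon (agree_qsum (M := M) w le) //.
by case: M lt.
Qed.

Lemma qsum_supp (w : nat -> R) (e : nat -> nat) n :
  (forall t, e t = n -> w t = 0) -> qsum w e n = 0.
Proof. by move=> h; rewrite /qsum big1 // => t /eqP; apply: h. Qed.

End Agree.

(** * Gaussian binomials and the q-binomial theorem *)

Section QBinomial.
Variable S : comNzRingType.
Implicit Types (p u v : S).

(** The Gaussian binomials, defined by a Pascal rule so that no division is
    needed and p may be any element of a commutative ring. *)
Fixpoint qbin p (n j : nat) : S :=
  match n, j with
  | _, 0 => 1
  | 0, _.+1 => 0
  | n'.+1, j'.+1 => qbin p n' j + p ^+ (n' - j') * qbin p n' j'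
  end.

Arguments qbin : simpl never.

Lemma qbinS p n j :
  qbin p n.+1 j.+1 = qbin p n j.+1 + p ^+ (n - j) * qbin p n j.
Proof. by []. Qed.

Lemma qbin0 p n : qbin p n 0 = 1. Proof. by case: n. Qed.

Lemma qbin_small p n j : (n < j)%N -> qbin p n j = 0.
Proof.
elim: n j => [|n IHn] [|j] // lt; rewrite qbinS !IHn ?mulr0 ?addr0 //.
exact: ltnW.
Qed.

Lemma qbinomial p u v n :
  \prod_(0 <= i < n) (v + u * p ^+ i)
    = \sum_(0 <= j < n.+1) qbin p n j * p ^+ 'C(j, 2) * u ^+ j * v ^+ (n - j).
Proof.
elim: n => [|n IHn]; first by rewrite big_nil big_nat1 qbin0 !mulr1.
rewrite big_nat_recr //= IHn mulrDr [RHS]big_nat_recl // qbin0.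
under [X in _ = _ + X]eq_bigr => j _ do rewrite qbinS !mulrDl.
rewrite big_split /= addrA; congr (_ + _).
  rewrite big_nat_recl // [in RHS]big_nat_recr //= (qbin_small p (ltnSn n)) !mul0r addr0.
  rewrite mulrDl qbin0 !subn0 -!mulrA -exprSr; congr (_ + _).
  rewrite mulr_suml; apply: eq_big_nat => j /andP[_ lt].
  by rewrite -!mulrA -exprSr subSn.
rewrite mulr_suml; apply: eq_big_nat => j /andP[_ lt].
rewrite subSS binS bin1 exprD.
have -> : p ^+ n = p ^+ (n - j) * p ^+ j by rewrite -exprD subnK.
by rewrite exprS; ring.
Qed.

Definition qpoch p n := \prod_(0 <= i < n) (1 - p ^+ i.+1).

Lemma qpochS p n : qpoch p n.+1 = qpoch p n * (1 - p ^+ n.+1).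
Proof. by rewrite /qpoch big_nat_recr. Qed.

Lemma qbin_poch p n j : (j <= n)%N ->
  qpoch p j * qpoch p (n - j) * qbin p n j = qpoch p n.
Proof.
elim: n j => [|n IHn] [|j] // le; try by rewrite qbin0 subn0 /qpoch big_nil !mulr1 ?mul1r.
have := le; rewrite ltnS leq_eqVlt => /predU1P[ejn|lt].
  rewrite ejn subSS qbinS (qbin_small p (ltnSn n)) subnn expr0 add0r mul1r.
  have := IHn n (leqnn n); rewrite subnn => E.
  by rewrite !qpochS -[in RHS]E; ring.
have E1 := IHn j.+1 lt; have E2 := IHn j (ltnW lt).
rewrite qbinS subSS; have enj : (n - j = (n - j.+1).+1)%N by lia.
have -> : qpoch p j.+1 * qpoch p (n - j) * (qbin p n j.+1 + p ^+ (n - j) * qbin p n j)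
  = (qpoch p j.+1 * qpoch p (n - j.+1) * qbin p n j.+1) * (1 - p ^+ (n - j))
   + (qpoch p j * qpoch p (n - j) * qbin p n j) * (p ^+ (n - j) * (1 - p ^+ j.+1)).
  by rewrite enj !qpochS; ring.
have en : p ^+ n.+1 = p ^+ (n - j) * p ^+ j.+1 by rewrite -exprD; congr (_ ^+ _); lia.
by rewrite E1 E2 qpochS en; ring.
Qed.

End QBinomial.

(** * The Jacobi triple product *)

Lemma bin2S n : 'C(n.+1, 2) = ('C(n, 2) + n)%N.
Proof. by rewrite binS bin1. Qed.

Lemma bin2D m t : 'C(m + t, 2) = ('C(m, 2) + 'C(t, 2) + m * t)%N.
Proof.
elim: t => [|t IHt]; first by rewrite addn0 muln0 !addn0.
by rewrite addnS !bin2S IHt; nia.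
Qed.

Lemma bin2_sq n : (n * n = 2 * 'C(n, 2) + n)%N.
Proof. by elim: n => // n IHn; rewrite bin2S; nia. Qed.

Lemma leq_bin2 n : (n <= 'C(n, 2).+1)%N.
Proof. by elim: n => // -[|n] // IHn; rewrite bin2S; lia. Qed.

Section FiniteTriple.
Variable S : comNzRingType.
Implicit Types (p u v : S).

Lemma prod_expr_bin2 p m : \prod_(0 <= i < m) p ^+ i = p ^+ 'C(m, 2).
Proof.
by elim: m => [|m IHm]; rewrite ?big_nil // big_nat_recr //= IHm bin2S exprD.
Qed.

(** For i < m the term u p^i is factored out as p^i, for i >= m the term p^m
    is. This turns the q-binomial product into the two halves of the triple
    product without negative powers of p. *)
Lemma triple_prod p u m :
  \prod_(0 <= i < 2 * m) (p ^+ m + u * p ^+ i)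
    = p ^+ (m * m + 'C(m, 2)) * \prod_(0 <= k < m) (1 + u * p ^+ k)
        * \prod_(0 <= k < m) (p ^+ k.+1 + u).
Proof.
rewrite (@big_cat_nat _ _ _ m) //=; last by lia.
have -> : \prod_(0 <= i < m) (p ^+ m + u * p ^+ i)
        = p ^+ 'C(m, 2) * \prod_(0 <= k < m) (p ^+ k.+1 + u).
  rewrite -prod_expr_bin2 [X in _ * X]big_nat_rev /= -big_split /=.
  apply: eq_big_nat => i /andP[_ lt]; rewrite add0n subnSK //.
  have -> : p ^+ m = p ^+ i * p ^+ (m - i) by rewrite -exprD subnKC // ltnW.
  by ring.
have -> : \prod_(m <= i < 2 * m) (p ^+ m + u * p ^+ i)
        = p ^+ (m * m) * \prod_(0 <= k < m) (1 + u * p ^+ k).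
  rewrite -{1}[m]add0n big_addn mul2n -addnn addnK exprM.
  have -> : (p ^+ m) ^+ m = \prod_(0 <= i < m) p ^+ m.
    by rewrite prodr_const_nat subn0.
  rewrite -big_split /=; apply: eq_bigr => i _.
  by rewrite exprD; ring.
by rewrite exprD; ring.
Qed.

Definition triple_term p u m j :=
  qbin p (2 * m) j * p ^+ 'C(j, 2) * u ^+ j * (p ^+ m) ^+ (2 * m - j).

Lemma triple_termD p u m t : (t <= m)%N ->
  triple_term p u m (m + t)
    = p ^+ (m * m + 'C(m, 2)) * u ^+ m
        * (qbin p (2 * m) (m + t) * (p ^+ 'C(t, 2) * u ^+ t)).
Proof.
move=> le; rewrite /triple_term -exprM -!mulrA.
have -> : p ^+ (m * m + 'C(m, 2)) * (u ^+ m * (qbin p (2 * m) (m + t) *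
   (p ^+ 'C(t, 2) * u ^+ t))) = qbin p (2 * m) (m + t) *
   (p ^+ (m * m + 'C(m, 2) + 'C(t, 2)) * u ^+ (m + t)) by rewrite !exprD; ring.
congr (_ * _); rewrite mulrCA mulrC -exprD; congr (_ ^+ _ * _).
by rewrite bin2D; nia.
Qed.

Lemma triple_termB p u v m i : u * v = p -> (i <= m)%N ->
  triple_term p u m (m - i)
    = p ^+ (m * m + 'C(m, 2)) * u ^+ m
        * (qbin p (2 * m) (m - i) * (p ^+ 'C(i, 2) * v ^+ i)).
Proof.
move=> uv le; rewrite /triple_term -exprM -!mulrA.
have um : u ^+ m = u ^+ (m - i) * u ^+ i by rewrite -exprD subnK.
have uvi : u ^+ i * v ^+ i = p ^+ i by rewrite -exprMn uv.
have -> : p ^+ (m * m + 'C(m, 2)) * (u ^+ m * (qbin p (2 * m) (m - i) *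
   (p ^+ 'C(i, 2) * v ^+ i))) = qbin p (2 * m) (m - i) *
   (p ^+ (m * m + 'C(m, 2) + 'C(i, 2)) * (u ^+ i * v ^+ i) * u ^+ (m - i)).
  by rewrite um !exprD; ring.
rewrite uvi; congr (_ * _); rewrite mulrCA mulrC -!exprD; congr (_ ^+ _ * _).
have [l em] : exists l, m = (i + l)%N by exists (m - i)%N; rewrite subnKC.
by rewrite em addKn bin2D; have := bin2_sq i; nia.
Qed.

(** The q-binomial sum, recentred at its middle term. The relation u v = p
    trades the negative powers of u below the centre for powers of v. The
    weights w allow the same computation to serve for the sum and for its
    derivative in u. *)
Lemma triple_sum p u v m (w : nat -> S) : u * v = p ->
  \sum_(0 <= j < (2 * m).+1) w j * triple_term p u m j
    = p ^+ (m * m + 'C(m, 2)) * u ^+ m *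
      (\sum_(0 <= t < m.+1)
          qbin p (2 * m) (m + t) * (w (m + t)%N * (p ^+ 'C(t, 2) * u ^+ t)) +
       \sum_(0 <= i < m)
          qbin p (2 * m) (m - i.+1)
            * (w (m - i.+1)%N * (p ^+ 'C(i.+1, 2) * v ^+ i.+1))).
Proof.
move=> uv; rewrite (@big_cat_nat _ _ _ m) //=; last by lia.
rewrite addrC mulrDr; congr (_ + _).
  rewrite -{1}[m]add0n big_addn mulr_sumr.
  have -> : ((2 * m).+1 - m = m.+1)%N by lia.
  apply: eq_big_nat => t /andP[_ lt].
  by rewrite addnC triple_termD //; ring.
rewrite big_nat_rev mulr_sumr; apply: eq_big_nat => i /andP[_ lt].
by rewrite add0n (triple_termB uv) //; ring.
Qed.

Lemma qbin_polyC p n j : qbin p%:P n j = (qbin p n j)%:P.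
Proof.
elim: n j => [|n IHn] [|j]; try by rewrite ?qbin0 ?qbin_small.
by rewrite !qbinS !IHn -rmorphXn -rmorphM -rmorphD.
Qed.

Lemma sum_triple p u m :
  \sum_(0 <= j < (2 * m).+1) triple_term p u m j
    = \prod_(0 <= i < 2 * m) (p ^+ m + u * p ^+ i).
Proof. by rewrite qbinomial. Qed.

Lemma triple_finite p u v m : u * v = p ->
  p ^+ (m * m + 'C(m, 2)) * u ^+ m *
   (\prod_(0 <= k < m) (1 + u * p ^+ k) * \prod_(0 <= k < m) (1 + v * p ^+ k))
  = p ^+ (m * m + 'C(m, 2)) * u ^+ m *
      (\sum_(0 <= t < m.+1)
          qbin p (2 * m) (m + t) * (p ^+ 'C(t, 2) * u ^+ t) +
       \sum_(0 <= i < m)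
          qbin p (2 * m) (m - i.+1) * (p ^+ 'C(i.+1, 2) * v ^+ i.+1)).
Proof.
move=> uv; have /= := triple_sum m (fun=> 1) uv.
under eq_bigr do rewrite mul1r.
under [X in _ = _ * (X + _)]eq_bigr do rewrite mul1r.
under [X in _ = _ * (_ + X)]eq_bigr do rewrite mul1r.
move=> <-; rewrite sum_triple triple_prod.
have -> : \prod_(0 <= k < m) (p ^+ k.+1 + u)
        = u ^+ m * \prod_(0 <= k < m) (1 + v * p ^+ k).
  have -> : u ^+ m = \prod_(0 <= k < m) u by rewrite prodr_const_nat subn0.
  rewrite -big_split /=; apply: eq_bigr => k _.
  by rewrite exprS -{1}uv; ring.
by ring.
Qed.

End FiniteTriple.

(** With u = - X for an indeterminate X, the finite product has a simple zero
    at X = 1. Evaluating it and its derivative there gives the finite form of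
    Jacobi's identity. *)
Lemma triple_finite_deriv (S : comNzRingType) (p : S) m :
  \sum_(0 <= j < (2 * m.+1).+1) triple_term p (-1) m.+1 j = 0 /\
  \sum_(0 <= j < (2 * m.+1).+1) j%:R * triple_term p (-1) m.+1 j
    = - (p ^+ (m.+1 * m.+1 + 'C(m.+1, 2)) * (-1) ^+ m.+1)
        * (qpoch p m * qpoch p m.+1).
Proof.
set M := m.+1.
pose P : {poly S} := \sum_(0 <= j < (2 * M).+1) triple_term p%:P (- 'X) M j.
pose c j := qbin p (2 * M) j * p ^+ 'C(j, 2) * (p ^+ M) ^+ (2 * M - j).
have termE u j : triple_term p u M j = c j * u ^+ j.
  by rewrite /triple_term /c; ring.
have PE : P = \sum_(0 <= j < (2 * M).+1) ((c j * (-1) ^+ j)%:P * 'X^j).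
  apply: eq_bigr => j _; rewrite /triple_term qbin_polyC [(- 'X) ^+ j]exprNn /c.
  by rewrite !polyCM !polyC_exp polyCN polyC1; ring.
(* Q collects all factors but the one with k = 0, which is 1 - X. *)
pose Q : {poly S} := (p%:P) ^+ (M * M + 'C(M, 2))
   * \prod_(0 <= k < m) (1 - 'X * p%:P ^+ k.+1)
   * \prod_(0 <= k < M) (p%:P ^+ k.+1 - 'X).
have PQ : P = (1 - 'X) * Q.
  rewrite /P sum_triple triple_prod big_nat_recl // expr0 mulr1 /Q.
  under [X in _ * (_ * X) * _ = _]eq_bigr do rewrite mulNr.
  by ring.
have X1 : (1 - 'X : {poly S}).[1] = 0 by rewrite !hornerE subrr.
have P1 : P.[1] = 0 by rewrite PQ hornerM X1 mul0r.
have Q1 : Q.[1] = p ^+ (M * M + 'C(M, 2)) * (-1) ^+ M * (qpoch p m * qpoch p M).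
  have -> : (-1) ^+ M = \prod_(0 <= k < M) (-1) :> S.
    by rewrite prodr_const_nat subn0.
  rewrite /Q !hornerM !horner_prod -polyC_exp hornerC -!mulrA; congr (_ * _).
  rewrite mulrCA; congr (_ * _); last rewrite /qpoch -big_split /=.
    by apply: eq_bigr => k _; rewrite -polyC_exp !hornerE.
  by apply: eq_bigr => k _; rewrite -polyC_exp !hornerE; ring.
have dP1 : P^`().[1] = - Q.[1].
  rewrite PQ derivM hornerD !hornerM X1 mul0r addr0 derivB derivX derivC.
  by rewrite sub0r hornerN hornerC mulN1r.
split.
  transitivity P.[1]; last exact: P1.
  rewrite PE horner_sum; apply: eq_bigr => j _.
  by rewrite hornerM hornerXn hornerC expr1n mulr1 termE.
rewrite mulNr -Q1 -dP1 PE raddf_sum horner_sum; apply: eq_bigr => j _.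
rewrite /= derivM derivC mul0r add0r derivXn hornerM hornerC hornerMn hornerXn.
by rewrite expr1n termE; ring.
Qed.

Section Triple.
Implicit Types (e : int) (c r s m : nat).

Lemma qpoch_qprodn c n : qpoch (qX c : series int) n = qprodn (-1) c c n.
Proof.
apply: eq_bigr => i _; congr (1 + _).
rewrite monX expr1n mulnS addnC; apply: serP => k; rewrite coefN /mon.
by case: eqP => //; rewrite oppr0.
Qed.

(** The Gaussian binomials near the centre converge to the inverse of prod_k
    (1 - q^(c k)), because numerator and denominators all converge to that
    product. *)
Lemma agree_qbin c m j N : (0 < c)%N -> (N <= j)%N -> (j + N <= 2 * m)%N ->
  agree N (qprod (-1) c c * qbin (qX c) (2 * m) j) (1 : series int).
Proof.
move=> c0 leNj lejm; have F0 := qprod0 (-1 : int) c0 c0.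
apply: (agree_mulI F0); rewrite mulr1 mulrA.
have := @qbin_poch _ (qX c : series int) (2 * m) j; rewrite !qpoch_qprodn => E.
have agr k : (N <= k)%N -> agree N (qprod (-1) c c) (qprodn (-1 : int) c c k).
  by move=> le; apply/agree_sym/agree_qprod.
apply: agree_trans (agree_sym (agr (2 * m)%N _)); last by lia.
rewrite -E; last by lia.
by apply: agree_mul => //; apply: agree_mul; apply: agr; lia.
Qed.

(** The poorer convergence of the binomials far from the centre is compensated
    by the quadratic growth of the exponents. *)
Lemma agree_triple_up c m (x : nat -> int) (e : nat -> nat) :
    (0 < c)%N -> (forall t, 'C(t, 2) <= e t)%N ->
  agree m.-1 (qprod (-1) c c *
     \sum_(0 <= t < m.+1) qbin (qX c) (2 * m) (m + t) * mon (x t) (e t))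
   (qsum x e).
Proof.
move=> c0 le.
apply: agree_trans (agree_leq (leq_pred m) (agree_qsum (M := m.+1) x _)); last first.
  by move=> t; apply: leq_trans (leq_bin2 t) _; rewrite ltnS.
rewrite mulr_sumr 2!big_mkord; apply: agree_sum => t _.
rewrite mulrA mulrC -[X in agree _ _ X]mulr1.
have ltt := ltn_ord t.
apply: (agree_monM (N := (m - t)%N)); last by apply: agree_qbin; lia.
by have := le t; have := leq_bin2 t; lia.
Qed.

Lemma agree_triple_down c m (x : nat -> int) (e : nat -> nat) :
    (0 < c)%N -> (forall t, 'C(t.+1, 2) <= e t)%N ->
  agree m.-1 (qprod (-1) c c *
     \sum_(0 <= i < m) qbin (qX c) (2 * m) (m - i.+1) * mon (x i) (e i))
   (qsum x e).
Proof.
move=> c0 le; apply: agree_trans (agree_qsum (M := m) x _); last first.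
  by move=> t; have := le t; have := leq_bin2 t.+1; lia.
rewrite mulr_sumr 2!big_mkord; apply: agree_sum => i _.
rewrite mulrA mulrC -[X in agree _ _ X]mulr1.
have lti := ltn_ord i.
apply: (agree_monM (N := (m - i.+1)%N)); last by apply: agree_qbin; lia.
by have := le i; have := leq_bin2 i.+1; lia.
Qed.

(** The triple product identity with z = e q^r, for a sign e. All theta series
    below are instances: r = s for phi, r = 0 for psi, (1, 2) for the
    pentagonal numbers. *)
Theorem triple_product e c r s : e * e = 1 -> (0 < c)%N -> (r + s = c)%N ->
  qprod (-1) c c * (qprod e c r * qprod e c s)
    = qsum (fun t => e ^+ t) (fun t => c * 'C(t, 2) + r * t)%N
      + qsum (fun i => e ^+ i.+1) (fun i => c * 'C(i.+1, 2) + s * i.+1)%N.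
Proof.
move=> ee c0 rs; pose p : series int := qX c.
have uv : mon e r * mon e s = p by rewrite mon_mul ee rs.
apply: agree_eq => N; apply: (@agree_leq _ N.+1.-1) => //.
set m := N.+1.
have prodE d : \prod_(0 <= k < m) (1 + mon e d * p ^+ k) = qprodn e c d m.
  apply: eq_bigr => i _; congr (1 + _).
  by rewrite monX expr1n mon_mul mulr1 addnC.
have termE d t : p ^+ 'C(t, 2) * mon e d ^+ t = mon (e ^+ t) (c * 'C(t, 2) + d * t).
  by rewrite !monX mon_mul expr1n mul1r.
have := triple_finite m uv; rewrite !prodE //.
set K := _ * mon e r ^+ m => E.
have {}E : qprodn e c r m * qprodn e c s m =
  \sum_(0 <= t < m.+1)
          qbin p (2 * m) (m + t) * mon (e ^+ t) (c * 'C(t, 2) + r * t) +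
  \sum_(0 <= i < m)
     qbin p (2 * m) (m - i.+1) * mon (e ^+ i.+1) (c * 'C(i.+1, 2) + s * i.+1).
  under [X in _ = X + _]eq_bigr do rewrite -termE.
  under [X in _ = _ + X]eq_bigr do rewrite -termE.
  have [d Kd] : exists d, mon e r ^+ m * K = qX d.
    exists (r * m + (c * (m * m + 'C(m, 2)) + r * m))%N.
    by rewrite /K !monX !mon_mul expr1n mul1r -exprMn ee expr1n.
  by apply: (@mon_inj _ d); rewrite -Kd -[LHS]mulrA E mulrA.
apply: agree_trans (_ : agree _ (qprod (-1) c c * (qprodn e c r m * qprodn e c s m)) _).
  apply: agree_mul => //; apply: agree_sym.
  by apply: agree_mul; apply: agree_qprod => //; apply: leq_pred.
rewrite E mulrDr; apply: agree_add.
  by apply: agree_triple_up => // t; nia.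
by apply: agree_triple_down => // t; nia.
Qed.

(** The limit of the finite derivative identity. Subtracting m times the
    vanishing sum from the derivative recentres the weights, and the terms t
    and 1 - t, which have equal exponents, are then added. *)
Theorem jacobi_cube :
  qprod (-1 : int) 1 1 ^+ 3
    = qsum (fun n => (-1) ^+ n * (2 * n + 1)%N%:R) (fun n => 'C(n.+1, 2)).
Proof.
pose p : series int := qX 1; set f1 := qprod _ _ _.
have uv : (-1) * (- p) = p by rewrite mulN1r opprK.
have -> : qsum (fun n => (-1) ^+ n * (2 * n + 1)%N%:R) (fun n => 'C(n.+1, 2))
  = - (qsum (fun t => t%:R * (-1) ^+ t) (fun t => 'C(t, 2))
      + qsum (fun i => - (i.+1%:R * (-1) ^+ i.+1) : int) (fun i => 'C(i.+1, 2) + i.+1)%N).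
  have shift (w : nat -> int) (e : nat -> nat) : (forall t, t <= (e t).+1)%N ->
     w 0%N = 0 -> qsum w e = qsum (fun n => w n.+1) (fun n => e n.+1).
    move=> le w0; rewrite qsum_shift // w0.
    by apply: serP => n; rewrite coefD /mon if_same add0r.
  have -> : qsum (fun i => - (i.+1%:R * (-1) ^+ i.+1) : int)
       (fun i => 'C(i.+1, 2) + i.+1)%N
    = qsum (fun i => - (i%:R * (-1) ^+ i) : int) (fun i => 'C(i.+1, 2)).
    have le t : (t <= ('C(t.+1, 2)).+1)%N by rewrite bin2S; have := leq_bin2 t; lia.
    rewrite [RHS](shift _ _ le) ?mul0r ?oppr0 //.
    by apply: serP => n; apply: eq_bigl => i; rewrite [in RHS]bin2S.
  rewrite (shift _ _ leq_bin2) ?mul0r //.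
  apply: serP => n; rewrite coefN coefD /qsum -big_split -sumrN /=.
  by apply: eq_bigr => i _; rewrite exprS natrD natrM -natr1; ring.
apply: oppr_inj; rewrite opprK; apply: agree_eq => N.
apply: (@agree_leq _ N.+1.-1) => //; set m := N.+1.
have [E0 E1] := triple_finite_deriv p N.
have E2 : \sum_(0 <= j < (2 * m).+1) mon (j%:R - m%:R) 0 * triple_term p (-1) m j
    = - (p ^+ (m * m + 'C(m, 2)) * (-1) ^+ m) * (qpoch p N * qpoch p m).
  transitivity (\sum_(0 <= j < (2 * m).+1) j%:R * triple_term p (-1) m j
      - m%:R * \sum_(0 <= j < (2 * m).+1) triple_term p (-1) m j).
    2: by rewrite E0 E1 mulr0 subr0.
  rewrite mulr_sumr -sumrB.
  apply: eq_bigr => j _; rewrite -mulrBl; congr (_ * _).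
  apply: serP => n; rewrite coefB !coefMn !coef1 /mon.
  by case: eqP => _; rewrite ?mul0rn ?subr0.
have := triple_sum m (fun j => mon (j%:R - m%:R : int) 0) uv; rewrite E2.
set K := _ * (-1) ^+ m => E.
have {}E : - (qpoch p N * qpoch p m) =
  \sum_(0 <= t < m.+1)
     qbin p (2 * m) (m + t) * mon (t%:R * (-1) ^+ t) 'C(t, 2) +
  \sum_(0 <= i < m)
     qbin p (2 * m) (m - i.+1)
       * mon (- (i.+1%:R * (-1) ^+ i.+1)) ('C(i.+1, 2) + i.+1).
  have [d Kd] : exists d, (-1) ^+ m * K = qX d.
    exists (m * m + 'C(m, 2))%N.
    by rewrite /K mulrCA -exprMn mulrNN mulr1 expr1n mulr1 monX expr1n mul1n.
  have signE k : (-1) ^+ k = mon ((-1) ^+ k) 0 :> series int.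
    have -> : -1 = mon (-1) 0 :> series int.
      by apply: serP => -[|n]; rewrite coefN coef1 /mon //= oppr0.
    by rewrite monX.
  apply: (@mon_inj _ d); rewrite -Kd -[LHS]mulrA mulrN -mulNr E -[RHS]mulrA.
  congr (_ * (_ * (_ + _))).
    apply: eq_bigr => t _; rewrite natrD addrC addKr signE monX expr1n.
    by rewrite !mon_mul mul1r mul1n addn0.
  apply: eq_big_nat => i /andP[_ lt]; rewrite [(- p) ^+ _]exprNn signE !monX !expr1n.
  rewrite !mon_mul natrB // !mul1n mulr1 mul1r; congr (_ * mon _ _).
  by ring.
have agr n : (N <= n)%N -> agree N f1 (qpoch p n).
  by move=> le; rewrite qpoch_qprodn; apply/agree_sym/agree_qprod.
apply: agree_trans (_ : agree _ (f1 * - (qpoch p N * qpoch p m)) _).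
  rewrite exprS expr2 -mulrN; apply: agree_mul => //; apply: agree_opp.
  by apply: agree_mul; apply: agr.
rewrite E mulrDr; apply: agree_add.
  exact: agree_triple_up.
by apply: agree_triple_down => // t; apply: leq_addr.
Qed.

End Triple.

(** * Theta functions *)

(** Sums over all integers, split as nonnegative and negative because that is
    the form in which the triple product delivers them. *)
Definition qsumz (w : int -> int) (e : int -> nat) : series int :=
  qsum (fun t : nat => w t) (fun t : nat => e t)
  + qsum (fun i => w (Negz i)) (fun i => e (Negz i)).

(** phi(q) for s = 1 and phi(-q) for s = -1. It is locked so that rewriting
    with additivity does not see the two halves of the sum. *)
HB.lock Definition phi_sg (s : int) : series int :=
  qsumz (fun k => s ^+ `|k|) (fun k => (`|k| * `|k|)%N).
Local Notation phi := (phi_sg 1).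
Local Notation phim := (phi_sg (-1)).
HB.lock Definition psi : series int := qsum (fun=> 1) (fun t => 'C(t.+1, 2)).

(* The product of 1 - q^k over all k is f1, over even k f2, over odd k Om;
   that of 1 + q^k over all k is E1, over even k Ev, over odd k O. *)
Local Notation f1 := (qprod (-1 : int) 1 1).
Local Notation f2 := (sub 2 f1).
Local Notation Om := (qprod (-1 : int) 2 1).
Local Notation O := (qprod (1 : int) 2 1).
Local Notation E1 := (qprod (1 : int) 1 1).
Local Notation Ev := (sub 2 E1).

Lemma f2E : f2 = qprod (-1) 2 2. Proof. exact: sub_qprod. Qed.
Lemma EvE : Ev = qprod 1 2 2. Proof. exact: sub_qprod. Qed.

Lemma f1_0 : f1 0%N = 1. Proof. exact: qprod0. Qed.
Lemma f2_0 : f2 0%N = 1. Proof. by rewrite coef0_sub f1_0. Qed.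

Lemma f1_split : f1 = Om * f2.
Proof. by rewrite [LHS](qprod_split (d := 2)) // !big_ord_recr big_ord0 /= mul1r f2E. Qed.

Lemma E1_split : E1 = O * Ev.
Proof. by rewrite [LHS](qprod_split (d := 2)) // !big_ord_recr big_ord0 /= mul1r EvE. Qed.

(** Factor by factor, (1 + q^k)(1 - q^k) = 1 - q^(2k). *)
Lemma E1_f1 : E1 * f1 = f2.
Proof.
rewrite f2E; apply/esym/qprod_eq => // m.
have -> : qprodn (-1 : int) 2 2 m = qprodn 1 1 1 m * qprodn (-1) 1 1 m.
  rewrite /qprodn -big_split; apply: eq_bigr => k _ /=.
  have -> : mon (-1 : int) (2 * k + 2) = mon 1 (1 * k + 1) * mon (-1) (1 * k + 1).
    by rewrite mon_mul mul1r; congr mon; lia.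
  have -> : mon (-1 : int) (1 * k + 1) = - mon 1 (1 * k + 1).
    by apply: serP => n; rewrite coefN /mon; case: eqP; rewrite ?oppr0.
  by ring.
by apply: agree_mul; apply: agree_qprod.
Qed.

(** Euler: partitions into distinct parts and into odd parts are
    equinumerous. *)
Lemma E1_Om : E1 * Om = 1.
Proof.
by apply: (series_mulI f2_0); rewrite mulr1 mulrCA [f2 * _]mulrC -f1_split E1_f1.
Qed.

(** Equivalently (1 - q^k)(1 + q^k) = 1 - q^(2k) over odd k; it is derived
    from the two preceding identities at q and at q^2. *)
Lemma Om_O : Om * O = sub 2 Om.
Proof.
have Ev0 : Ev 0%N = 1 by rewrite coef0_sub qprod0.
apply: (series_mulI Ev0); rewrite -subM // E1_Om sub1 //.
transitivity ((O * Ev) * Om); first by ring.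
by rewrite -E1_split E1_Om.
Qed.

Lemma phi_prod s : s * s = 1 -> phi_sg s = f2 * (qprod s 2 1 * qprod s 2 1).
Proof.
move=> ss; rewrite f2E (triple_product ss) // phi_sg.unlock; congr (_ + _).
  by apply: eq_qsum => // t; have := bin2_sq t; rewrite absz_nat; lia.
by apply: eq_qsum => // t; have := bin2_sq t.+1; rewrite NegzE abszN absz_nat; lia.
Qed.

Lemma phiE : phi = f2 * (O * O). Proof. exact: phi_prod. Qed.
Lemma phimE : phim = f2 * (Om * Om). Proof. exact: phi_prod. Qed.

Lemma psi_le t : (t <= 'C(t.+1, 2).+1)%N.
Proof. by have := leq_bin2 t.+1; lia. Qed.

(** The triple product with r = 0 has the factor 1 + q^0 = 2 and counts every
    triangular number twice. *)
Lemma psiE : psi = E1 * f2.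
Proof.
(* The q^0 term of the first factor has coefficient 2, whence the doubling. *)
rewrite -E1_f1; apply: (@series_intMI 2) => //.
have E0 : qprod (1 : int) 1 0 = E1 *+ 2.
  apply: agree_eq => m.
  apply: agree_trans (agree_sym (agree_qprod 1 0 (ltn0Sn 0) (leqnSn m))) _.
  have -> : qprodn (1 : int) 1 0 m.+1 = qprodn 1 1 1 m *+ 2.
    rewrite /qprodn big_nat_recl // muln0 mon0 mulrDl mul1r mulr2n.
    by congr (_ + _); apply: eq_bigr => k _; congr (1 + mon _ _); lia.
  by rewrite !mulr2n; apply: agree_add; apply: agree_qprod.
have e1 t : (t <= (1 * 'C(t, 2) + 0 * t).+1)%N by have := leq_bin2 t; lia.
have := @triple_product 1 1 0 1 erefl isT erefl.
rewrite E0 qsum_shift // mon0.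
have -> : qsum (fun t => 1 ^+ t.+1) (fun t => 1 * 'C(t.+1, 2) + 0 * t.+1)%N = psi.
  by rewrite psi.unlock; apply: eq_qsum => t; rewrite ?expr1n ?mul1n ?addn0.
have -> : qsum (fun i => 1 ^+ i.+1) (fun i => 1 * 'C(i.+1, 2) + 1 * i.+1)%N = psi - 1.
  rewrite psi.unlock [in RHS]qsum_shift; last exact: psi_le.
  rewrite mon0 addrC addKr; apply: eq_qsum => t; first by rewrite expr1n.
  by rewrite [in RHS]bin2S; lia.
move=> E; transitivity (1 + psi + (psi - 1)); first by ring.
by rewrite -E; ring.
Qed.

Lemma phi_phim : phi * phim = sub 2 phim ^+ 2.
Proof.
rewrite phimE !subM // -Om_O phiE.
have e : f2 = sub 2 Om * sub 2 f2 by rewrite -subM // -f1_split.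
rewrite -Om_O in e.
transitivity (f2 ^+ 2 * (Om * O) ^+ 2); first by ring.
by rewrite {1}e; ring.
Qed.

Lemma phi_sub_psi : phi * sub 2 psi = psi ^+ 2.
Proof.
have e : sub 2 psi = Ev * (Ev * f2) by rewrite psiE -{1}E1_f1 !subM.
rewrite e phiE psiE; transitivity ((O * Ev * f2) ^+ 2); first by ring.
by rewrite -E1_split.
Qed.

(** Both sides are products; this links Jacobi's series for the cube to
    phi(-q) and psi. *)
Lemma f1_cube : f1 ^+ 3 = phim ^+ 2 * psi.
Proof.
rewrite phimE psiE {1}f1_split.
transitivity (f2 ^+ 3 * Om ^+ 3 * (E1 * Om)); last by ring.
by rewrite E1_Om; ring.
Qed.

(** Even squares are 4 t^2 and odd squares are 8 t(t+1)/2 + 1. *)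
Lemma phi_sgE (s : int) : s * s = 1 ->
  phi_sg s = sub 4 phi + (mon s 1 * sub 8 psi) *+ 2.
Proof.
move=> ss; pose S (u : int) := qsum (fun t => u ^+ t) (fun t => t * t)%N.
have le t : (t <= (t * t).+1)%N by nia.
have phiS u : phi_sg u = S u *+ 2 - 1.
  have -> : phi_sg u = S u + (S u - 1); last by ring.
  rewrite phi_sg.unlock.
  congr (_ + _); rewrite /S [in RHS]qsum_shift // expr0 muln0 mon0 [1 + _]addrC addrK.
  by apply: eq_qsum => i; rewrite NegzE abszN absz_nat.
have SE u : u * u = 1 -> S u = sub 4 (S 1) + mon u 1 * sub 8 psi.
  move=> uu; rewrite /S qsum_parity //; congr (_ + _).
    rewrite sub_qsum //; apply: eq_qsum => t; last by lia.
    by rewrite exprM expr2 uu !expr1n.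
  rewrite psi.unlock sub_qsum ?mon_qsum //; last exact: psi_le.
    apply: eq_qsum => t; first by rewrite exprS exprM expr2 uu expr1n.
    by have := bin2_sq t.+1; lia.
  by move=> t; have := psi_le t; lia.
rewrite !phiS SE // subB raddfMn /= sub1 //.
by ring.
Qed.

Local Notation q := (qX 1 : series int).
Local Notation psi2 := (sub 2 psi).

Lemma phi_even_odd : phi = sub 4 phi + 2 * q * sub 8 psi.
Proof. by rewrite {1}phi_sgE //; ring. Qed.

Lemma phim_even_odd : phim = sub 4 phi - 2 * q * sub 8 psi.
Proof.
rewrite phi_sgE //; have -> : mon (-1) 1 = - q; last by ring.
by apply: serP => n; rewrite coefN /mon; case: eqP; rewrite ?oppr0.
Qed.

Lemma sub_q d k : (0 < d)%N -> sub d (qX k : series int) = q ^+ (d * k).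
Proof. by move=> d0; rewrite sub_mon // monX expr1n mul1n. Qed.

(** The difference d of the two sides satisfies d(q) = - d(q^2), by inserting
    the splitting of phi into even and odd powers; only d = 0 does. *)
Lemma phi_sq : phi ^+ 2 = sub 2 phi ^+ 2 + 4 * q * sub 4 psi ^+ 2.
Proof.
pose d := phi ^+ 2 - (sub 2 phi ^+ 2 + 4 * q * sub 4 psi ^+ 2).
have dE : d = - sub 2 d.
  have e : sub 4 phi * sub 8 psi = sub 4 psi ^+ 2.
    by rewrite -[8%N]/(4 * 2)%N -sub_sub // -subM // phi_sub_psi subX.
  have dE1 : d = sub 4 phi ^+ 2 + 4 * q ^+ 2 * sub 8 psi ^+ 2 - sub 2 phi ^+ 2.
    by rewrite /d -e {1}phi_even_odd; ring.
  rewrite {1}dE1 /d subB subD !subX // !subM // sub_nat //.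
  by rewrite !sub_sub // sub_q //; ring.
have d0 n : d n = 0.
  elim/ltn_ind: n => -[|n] IHn; last first.
    rewrite dE coefN /sub; case: ifP => [_|]; last by rewrite oppr0.
    by rewrite IHn ?oppr0 // ltn_Pdiv.
  have : d 0%N = - d 0%N by rewrite {1}dE coefN coef0_sub.
  by lia.
by apply/subr0_eq/serP => n; rewrite coef0; apply: d0.
Qed.

(** With phi(q) = s + t and phi(-q) = s - t, the left side is 8 s t (s^2 +
    t^2). *)
Lemma phi4_diff : phi ^+ 4 - phim ^+ 4 = 16 * q * psi2 ^+ 4.
Proof.
have e : sub 4 phi * sub 8 psi = sub 4 psi ^+ 2.
  by rewrite -[8%N]/(4 * 2)%N -sub_sub // -subM // phi_sub_psi subX.
have e2 : sub 4 phi ^+ 2 + 4 * q ^+ 2 * sub 8 psi ^+ 2 = sub 2 phi ^+ 2.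
  have /(congr1 (sub 2)) := phi_sq.
  rewrite subD !subX // !subM // sub_nat // !sub_sub // sub_q // => ->; ring.
have e3 : psi2 ^+ 2 = sub 2 phi * sub 4 psi.
  by rewrite -subX // -phi_sub_psi subM // sub_sub.
rewrite phi_even_odd phim_even_odd.
transitivity (16 * q * (sub 4 phi * sub 8 psi)
              * (sub 4 phi ^+ 2 + 4 * q ^+ 2 * sub 8 psi ^+ 2)); first by ring.
have -> : psi2 ^+ 4 = (psi2 ^+ 2) ^+ 2 by ring.
by rewrite e e2 e3; ring.
Qed.

(** The square of the previous formula for phi(q)^2, whose two terms are
    series in q^2 and q times such a series. *)
Lemma phi4_even_odd :
  phi ^+ 4 = sub 2 (phi ^+ 4 + 16 * q * psi2 ^+ 4) + 8 * q * sub 2 (psi ^+ 4).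
Proof.
have e3 : psi2 ^+ 2 = sub 2 phi * sub 4 psi.
  by rewrite -subX // -phi_sub_psi subM // sub_sub.
rewrite subD !subX // !subM // sub_nat // ?subX // !sub_sub // sub_q //.
transitivity ((phi ^+ 2) ^+ 2); first by ring.
have -> : psi2 ^+ 4 = (psi2 ^+ 2) ^+ 2 by ring.
by rewrite phi_sq e3; ring.
Qed.

(** * The four-square theorem *)

(** Coefficients of products of two sums over all integers are finite sums
    over such boxes. *)
Definition zbox (B : nat) : seq int :=
  [seq Posz t | t <- iota 0 B.+1] ++ [seq Negz t | t <- iota 0 B].

Lemma mem_zbox B k : (k \in zbox B) = (`|k| <= B)%N.
Proof.
rewrite mem_cat; apply/orP/idP => [[]/mapP[t]|].
- by rewrite mem_iota => /andP[_ lt] ->; lia.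
- by rewrite mem_iota => /andP[_ lt] ->; lia.
case: k => t le; [left|right]; apply: map_f; rewrite mem_iota; lia.
Qed.

Lemma zbox_uniq B : uniq (zbox B).
Proof.
rewrite cat_uniq !map_inj_uniq ?iota_uniq ?andbT; try by move=> x y [].
by apply/hasPn => x /mapP[t _ ->]; apply/mapP => -[].
Qed.

Lemma qsumz_mon B (w : int -> int) (e : int -> nat) n :
    (forall k, `|k| <= (e k).+1)%N -> (n.+2 <= B)%N ->
  qsumz w e n = (\sum_(k <- zbox B) mon (w k) (e k) : series int) n.
Proof.
move=> le leB; rewrite /zbox big_cat !big_map /qsumz !coefD.
rewrite (qsum_coef (M := B.+1)); [|by move=> t; apply: le|by lia].
rewrite (qsum_coef (M := B)); [|by move=> t; have := le (Negz t); lia|by lia].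
by rewrite -!coef_sum_mon /index_iota !subn0.
Qed.

Definition zbox2 B := [seq (k, l) | k <- zbox B, l <- zbox B].

Lemma mem_zbox2 B k l : ((k, l) \in zbox2 B) = (`|k| <= B)%N && (`|l| <= B)%N.
Proof.
apply/allpairsP/andP => [[[x y] /= [hx hy [-> ->]]]|[hk hl]].
  by rewrite -!mem_zbox.
by exists (k, l); rewrite !mem_zbox.
Qed.

Lemma zbox2_uniq B : uniq (zbox2 B).
Proof. by apply: allpairs_uniq; rewrite ?zbox_uniq // => -[a b] [c d]. Qed.

Lemma qsumzM_coef B (w w' : int -> int) (e e' : int -> nat) n :
    (forall k, `|k| <= (e k).+1)%N -> (forall k, `|k| <= (e' k).+1)%N ->
    (n.+2 <= B)%N ->
  (qsumz w e * qsumz w' e') n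
    = \sum_(x <- zbox2 B | (e x.1 + e' x.2 == n)%N) w x.1 * w' x.2.
Proof.
move=> le le' leB.
have ag (v : int -> int) (u : int -> nat) : (forall k, `|k| <= (u k).+1)%N ->
    agree n.+1 (qsumz v u) (\sum_(k <- zbox B) mon (v k) (u k)).
  by move=> leu m ltm; apply: qsumz_mon => //; lia.
rewrite (agree_mul (ag w e le) (ag w' e' le')) // big_distrlr /=.
rewrite coef_sum [RHS]big_mkcond /zbox2 big_allpairs /=.
apply: eq_bigr => k _; rewrite coef_sum; apply: eq_bigr => l _.
by rewrite mon_mul /mon eq_sym.
Qed.

(** Jacobi's series with the terms of odd index moved to the negative side by
    n -> - 1 - n, which preserves both exponent and weight. *)
Lemma f1_cube_qsumz :
  f1 ^+ 3 = qsumz (fun k => 4 * k + 1) (fun k => absz (2 * k * k + k)).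
Proof.
rewrite jacobi_cube qsum_parity; last exact: psi_le.
congr (_ + _); apply: eq_qsum => t.
- by rewrite exprM expr2 mulrNN !mulr1 expr1n mul1r; lia.
- by have := bin2_sq (2 * t).+1; nia.
- by rewrite exprS exprM expr2 mulrNN !mulr1 expr1n mulr1; lia.
- by have := bin2_sq (2 * t).+2; nia.
Qed.

Lemma psi2_qsumz :
  psi2 *+ 2 = qsumz (fun=> 1) (fun k => absz (k * k + k)).
Proof.
rewrite psi.unlock sub_qsum //; last exact: psi_le.
rewrite mulr2n; congr (_ + _); apply: eq_qsum => // t.
- by have := bin2_sq t.+1; nia.
- by have := bin2_sq t.+1; nia.
Qed.

Lemma theta_qsumz w e : theta (qsumz w e) = qsumz (fun k => w k *+ e k) e.
Proof. by rewrite /qsumz thetaD !theta_qsum. Qed.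

(** Multiplying the series for the cube by itself gives a sum over (k, l) with
    weight (4k+1)(4l+1). In the rotated coordinates r = k + l, s = k - l the
    weight is (2r+1)^2 - 4s^2 and the exponent is r^2 + r + s^2, so the
    variables separate. The pairs (r, s) so obtained are those of equal
    parity; the reflection r -> - 1 - r carries them to the others, whence the
    factor 2. *)
Theorem f1_sixth :
  f1 ^+ 6 = (psi2 + 4 * theta psi2) * phi - 4 * psi2 * theta phi.
Proof.
apply: (@series_intMI 2) => //.
have -> : ((psi2 + 4 * theta psi2) * phi - 4 * psi2 * theta phi) *+ 2
  = (psi2 *+ 2 + 4 * theta (psi2 *+ 2)) * phi - (psi2 *+ 2) * (4 * theta phi).
  by rewrite thetaMn; ring.
have Z1 : psi2 *+ 2 + 4 * theta (psi2 *+ 2)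
  = qsumz (fun k => (2 * k + 1) ^+ 2) (fun k => absz (k * k + k)).
  rewrite psi2_qsumz theta_qsumz; apply: serP => n.
  rewrite mulr_natl coefD coefMn /qsumz !coefD /qsum.
  rewrite !mulrnDl addrACA -!sumrMnl -!big_split /=.
  congr (_ + _); apply: eq_bigr => t _; nia.
have P1 : 4 * theta phi = qsumz (fun k => 4 * k ^+ 2) (fun k => `|k| * `|k|)%N.
  rewrite phi_sg.unlock theta_qsumz; apply: serP => n.
  rewrite mulr_natl coefMn /qsumz !coefD /qsum.
  rewrite !mulrnDl -!sumrMnl /=.
  congr (_ + _); apply: eq_bigr => t _; rewrite expr1n; nia.
rewrite Z1 psi2_qsumz P1 phi_sg.unlock; apply: serP => n.
have -> : f1 ^+ 6 = f1 ^+ 3 * f1 ^+ 3 by ring.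
rewrite coefMn coefB f1_cube_qsumz; pose B := n.+2.
rewrite !(qsumzM_coef (B := B)) //; try by [move=> k; nia | move=> k; rewrite /=; nia].
rewrite -sumrB -big_filter -[RHS]big_filter.
set A := filter _ _; set C := filter _ _.
pose F (x : int * int) : int * int := (x.1 + x.2, x.1 - x.2).
pose F' (x : int * int) : int * int := (- 1 - x.1 - x.2, x.1 - x.2).
have FI : injective F by move=> [a b] [c d] [h1 h2]; congr pair; lia.
have FI' : injective F' by move=> [a b] [c d] [h1 h2]; congr pair; lia.
have memA (a b : int) : ((a, b) \in A)
    = (absz (2 * a * a + a)%R + absz (2 * b * b + b)%R == n)%N.
  rewrite mem_filter mem_zbox2 /=; apply/andP/idP => [[]//|h]; split=> //.
  by move/eqP: h => h; apply/andP; split; nia.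
have memC (r s : int) : ((r, s) \in C) = (absz (r * r + r)%R + `|s| * `|s| == n)%N.
  rewrite mem_filter mem_zbox2 /=; apply/andP/idP => [[]//|h]; split=> //.
  by move/eqP: h => h; apply/andP; split; nia.
have key (k l r s : int) : (r = k + l \/ r = - 1 - k - l) -> s = k - l ->
    (absz (2 * k * k + k)%R + absz (2 * l * l + l)%R
     = absz (r * r + r)%R + `|s| * `|s|)%N.
  have tri (x : int) : absz (x * x + x) = x * x + x :> int by nia.
  have dbl (x : int) : absz (2 * x * x + x) = 2 * x * x + x :> int by nia.
  have sq (x : int) : (`|x| * `|x|)%N = x * x :> int by nia.
  move=> er es; apply/eqP; rewrite -eqz_nat !PoszD tri !dbl sq es.
  by apply/eqP; case: er => ->; ring.
(* F reaches the pairs with r + s even, F' those with r + s odd. *)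
have perm : perm_eq C (map F A ++ map F' A).
  apply: uniq_perm; first exact/filter_uniq/zbox2_uniq.
    rewrite cat_uniq !map_inj_uniq // !filter_uniq ?zbox2_uniq // andbT /=.
    apply/hasPn => x /mapP[[a b] _ ->]; apply/mapP => -[[c d] _ [h1 h2]]; lia.
  move=> [r s]; rewrite mem_cat memC; apply/idP/orP => [h|[]/mapP[[a b]]].
  - have [k [rs|rs]] : exists k : int, r + s = 2 * k \/ r + s = - 1 - 2 * k.
      have [m [h1|h1]] : exists m : int, r + s = 2 * m \/ r + s = 2 * m + 1.
        by exists ((r + s) %/ 2)%Z; lia.
      + by exists m; left.
      + by exists (- 1 - m); right; lia.
    + left; apply/mapP; exists (k, k - s); last by congr pair; rewrite /=; lia.
      by rewrite memA (key _ _ r s) //; [left|]; lia.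
    + right; apply/mapP; exists (s + k, k); last by congr pair; rewrite /=; lia.
      by rewrite memA (key _ _ r s) //; [right|]; lia.
  - by rewrite memA => h [er es]; rewrite -(key a b r s) //; left.
  - by rewrite memA => h [er es]; rewrite -(key a b r s) //; right.
rewrite (perm_big _ perm) /= big_cat !big_map /= -big_split /= -sumrMnl.
by apply: eq_bigr => -[a b] _ /=; rewrite expr1n; ring.
Qed.

(** Dividing by phi(q) psi(q^2) gives phi(-q)^4 = 1 - 4 theta log (phi(q) /
    psi(q^2)), whose coefficients are the divisor sums of Jacobi's theorem. *)
Corollary four_squares :
  phim ^+ 4 * (phi * psi2) = phi * psi2 + 4 * (phi * theta psi2 - psi2 * theta phi).
Proof.
rewrite phi_sub_psi.
have -> : phim ^+ 4 * psi ^+ 2 = f1 ^+ 6.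
  by transitivity ((f1 ^+ 3) ^+ 2); [rewrite f1_cube|]; ring.
by rewrite f1_sixth -phi_sub_psi; ring.
Qed.

(** * Enumeration of overpartitions *)

(** Both the ordering of the parts and the rule that only a first occurrence
    is overlined are captured by this one relation: after (v, _) there may
    come (v, false) or anything smaller. *)
Definition ovrel (p r : nat * bool) : bool := (r.1 + r.2 <= p.1)%N.

Lemma ovrel_trans : transitive ovrel.
Proof. by move=> [a b] [c d] [e f]; rewrite /ovrel /=; lia. Qed.

Definition ovseq (n : nat) (s : seq (nat * bool)) : bool :=
  [&& sorted ovrel s, all (fun r => 0 < r.1)%N s & sumn (unzip1 s) == n].

Lemma forall_ord_all n (P : nat -> bool) :
  [forall i : 'I_n, P i] = all P (iota 0 n).
Proof.
apply/forallP/allP => [h i|h i]; last by apply: h; rewrite mem_iota ltn_ord.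
by rewrite mem_iota => lt; apply: (h (Ordinal lt)).
Qed.

Lemma is_overpartitionE n s : is_overpartition n s = ovseq n s.
Proof.
rewrite /is_overpartition /ovseq all_map.
rewrite (forall_ord_all _ (fun i => (nth (0%N, false) s i).2 ==>
   (index (nth 0%N (unzip1 s) i) (unzip1 s) == i))).
have -> : sorted ovrel s = sorted geq (unzip1 s) &&
    all (fun i => (nth (0%N, false) s i).2 ==>
       (index (nth 0%N (unzip1 s) i) (unzip1 s) == i)) (iota 0 (size s)).
  have geq_trans : transitive geq by move=> a b c h1 h2; apply: leq_trans h1.
  rewrite (sorted_pairwise ovrel_trans) (sorted_pairwise geq_trans).
  elim: s => //= -[v b] s ->; rewrite eqxx implybT /=.
  have -> : all (ovrel (v, b)) s
      = all (geq v) (unzip1 s) && all (fun r => r.2 ==> (v != r.1)) s.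
    rewrite all_map -all_predI; apply: eq_all => -[w c].
    by rewrite /ovrel /=; case: c => /=; lia.
  have -> : all (fun r => r.2 ==> (v != r.1)) s
      = all (fun i => (nth (0%N, false) s i).2 ==> (v != nth 0%N (unzip1 s) i))
            (iota 0 (size s)).
    rewrite -[s in LHS](mkseq_nth (0%N, false)) /mkseq all_map.
    by apply: eq_in_all => i; rewrite mem_iota => lt; rewrite (nth_map (0%N, false)).
  rewrite (iotaDl 1 0) all_map -!andbA; congr (_ && _).
  rewrite andbCA; congr (_ && _); rewrite -all_predI; apply: eq_all => i /=.
  by case: (_.2) => //=; case: eqP.
by rewrite -!andbA; congr (_ && _); rewrite [RHS]andbC -!andbA.
Qed.

Lemma ovseq_nil n : ovseq n [::] = (n == 0%N).
Proof. by rewrite /ovseq /= eq_sym. Qed.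

Lemma ovseq_cons n v b s : ovseq n ((v, b) :: s)
  = [&& path ovrel (v, b) s, 0 < v, v <= n & ovseq (n - v) s]%N.
Proof.
rewrite /ovseq /= -!andbA.
have [ps|] := boolP (path ovrel (v, b) s); last by [].
rewrite (path_sorted ps) /=; case: (0 < v)%N => //=.
case: (all _ s) => /=; last by rewrite andbF.
by lia.
Qed.

(** Some plain copies of k, possibly none, in front of a member of D; the fuel
    f bounds their number. *)
Fixpoint add_copies (D : nat -> seq (seq (nat * bool))) (k f n : nat) :=
  D n ++ (if f is f'.+1 then
            if (k <= n)%N then [seq (k, false) :: s | s <- add_copies D k f' (n - k)]
            else [::]
          else [::]).

(** An overlined k can only come first, before all plain copies of k. *)
Fixpoint ovparts (k n : nat) : seq (seq (nat * bool)) :=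
  if k is k'.+1 then
    add_copies (ovparts k') k n n
      ++ (if (k <= n)%N
          then [seq (k, true) :: s | s <- add_copies (ovparts k') k (n - k) (n - k)]
          else [::])
  else if n == 0%N then [:: [::]] else [::].

Definition all_le k (s : seq (nat * bool)) := all (fun r => r.1 <= k)%N s.

Lemma ovseq_le n s : ovseq n s -> all_le n s.
Proof.
elim: s n => //= -[v b] s IHs n; rewrite ovseq_cons => /and4P[_ _ le /IHs h].
rewrite le /=; apply: sub_all h => r /= h; apply: leq_trans h (leq_subr _ _).
Qed.

Section Enumeration.
Variables (k : nat) (D : nat -> seq (seq (nat * bool))).
Hypothesis memD : forall n s, (s \in D n) = ovseq n s && all_le k s.
Hypothesis uniqD : forall n, uniq (D n).

(** A member either has all parts below k + 1 or starts with a plain k + 1,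
    because an overlined one cannot follow and plain copies of it come
    first. *)
Lemma mem_add_copies f n s : (n <= f)%N ->
  (s \in add_copies D k.+1 f n) = ovseq n s && all (ovrel (k.+1, false)) s.
Proof.
elim: f n s => [|f IHf] n s le; rewrite mem_cat memD.
  have n0 : n = 0%N by lia.
  rewrite n0 in_nil orbF; case: s => // -[v b] s.
  by rewrite ovseq_cons; case: v => [|v]; rewrite ?ltnn ?andbF ?andFb //= !andbF.
have -> : (s \in (if (k.+1 <= n)%N
      then [seq (k.+1, false) :: s0 | s0 <- add_copies D k.+1 f (n - k.+1)] else [::]))
   = [&& head (0%N, false) s == (k.+1, false), ovseq n s & all (ovrel (k.+1, false)) s].
  case: ltnP => [le_kn|lt_nk].
    apply/mapP/and3P => [[s']|[]].
      rewrite IHf; last by lia.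
      move=> /andP[os' as'] ->; rewrite /= ovseq_cons os' le_kn andbT /=.
      rewrite (path_sortedE ovrel_trans) as'; split=> //.
        by case/and3P: os' => ->.
      by rewrite /ovrel /= addn0 leqnn.
    case: s => // p s /= /eqP -> ; rewrite ovseq_cons => /and4P[_ _ _ os] /andP[_ as'].
    by exists s => //; rewrite IHf ?os //; lia.
  rewrite in_nil; apply/esym/negP => /and3P[]; case: s => //= p s /eqP ->.
  by rewrite ovseq_cons => /and4P[_ _]; lia.
case os: (ovseq n s); rewrite ?andbF //= andbC.
case: s os => //= -[v b] s; rewrite ovseq_cons => /andP[ps _].
have -> : ((v, b).1 <= k)%N && all_le k s = (v <= k)%N.
  rewrite [(v, b).1]/=; case: leqP => // le_vk /=; move: ps.
  rewrite (path_sortedE ovrel_trans) => /andP[h _]; apply: sub_all h.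
  by move=> [w c]; rewrite /ovrel /=; lia.
have [e|ne] := eqVneq (v, b) (k.+1, false).
  by move: e => [-> ->]; rewrite ltnn andbT.
move: ps; rewrite (path_sortedE ovrel_trans) => /andP[h _].
rewrite andbF orbF; apply/idP/andP => [le_vk|[hv _]].
  split; first by rewrite /ovrel /=; case: b {ne h} => /=; lia.
  by apply: sub_all h => -[w c]; rewrite /ovrel /=; lia.
move: hv ne; rewrite /ovrel /= xpair_eqE; case: b {h} => /=; lia.
Qed.

Lemma uniq_add_copies f n : (n <= f)%N -> uniq (add_copies D k.+1 f n).
Proof.
elim: f n => [|f IHf] n le /=; first by rewrite cats0.
case: ltnP => [le_kn|_]; last by rewrite cats0.
rewrite cat_uniq uniqD map_inj_uniq ?IHf ?andbT; [|by lia|by move=> x y []].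
by apply/hasPn => s /mapP[s' _ ->]; rewrite memD /all_le /= ltnn andbF.
Qed.

Lemma add_copies_fuel f n : (n <= f)%N -> add_copies D k.+1 f n = add_copies D k.+1 n n.
Proof.
elim/ltn_ind: n f => n IHn [|f] le; first by move: le; rewrite leqn0 => /eqP->.
case: n IHn le => [|n] IHn le //=; congr (_ ++ _).
by case: ltnP => // lekn; rewrite IHn ?[in RHS]IHn //; lia.
Qed.

End Enumeration.

Lemma ovparts_spec k :
  (forall n s, (s \in ovparts k n) = ovseq n s && all_le k s) /\
  (forall n, uniq (ovparts k n)).
Proof.
elim: k => [|k [memk uniqk]].
  split=> [n s|n] /=; last by case: ifP.
  case: s => [|[v b] s]; last first.
    rewrite /all_le /= ovseq_cons; case: v => [|v]; rewrite ?ltnn ?andbF ?andFb //=;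
    by case: ifP => _; rewrite ?inE ?in_nil ?andbF.
  by rewrite ovseq_nil andbT; case: ifP; rewrite ?inE.
have memC n s := mem_add_copies memk s (leqnn n).
split=> [n s|n] /=.
  rewrite mem_cat memC.
  have -> : (s \in (if (k.+1 <= n)%N
       then [seq (k.+1, true) :: s
               | s <- add_copies (ovparts k) k.+1 (n - k.+1) (n - k.+1)]
       else [::])) = [&& head (0%N, false) s == (k.+1, true) & ovseq n s].
    case: ltnP => [le_kn|lt_nk].
      apply/mapP/andP => [[s']|[]].
        rewrite memC => /andP[os' as'] ->; rewrite /= ovseq_cons os' le_kn andbT /=.
        rewrite (path_sortedE ovrel_trans) andbT; split=> //.
        by rewrite -[all _ _]/(all (ovrel (k.+1, false)) s') as'; case/and3P: os' => ->.
      case: s => // p s /= /eqP ->; rewrite ovseq_cons => /and4P[ps _ _ os].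
      exists s => //; rewrite memC os.
      by move: ps; rewrite (path_sortedE ovrel_trans) => /andP[].
    rewrite in_nil; apply/esym/negP => /andP[]; case: s => //= p s /eqP ->.
    by rewrite ovseq_cons => /and4P[_ _]; lia.
  case os: (ovseq n s); rewrite ?andbF // andbT /=.
  case: s os => // -[v b] s; rewrite ovseq_cons => /andP[ps _].
  rewrite /all_le /= xpair_eqE; move: ps.
  rewrite (path_sortedE ovrel_trans) => /andP[h _].
  have hle j : (v <= j)%N -> all (fun r => r.1 <= j)%N s.
    by move=> le; apply: sub_all h => -[w c]; rewrite /ovrel /=; lia.
  have hrel : (v <= k.+1)%N -> all (ovrel (k.+1, false)) s.
    by move=> le; apply: sub_all h => -[w c]; rewrite /ovrel /=; lia.
  rewrite {1}/ovrel /=; case: (leqP v k.+1) => [le|lt] /=; last first.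
    by case: b {h} => /=; lia.
  by rewrite hle // hrel // andbT; case: b {h} => /=; lia.
rewrite cat_uniq (uniq_add_copies memk uniqk) //=.
case: ltnP => [le_kn|_]; last by [].
rewrite map_inj_uniq ?(uniq_add_copies memk uniqk) ?andbT //; last by move=> x y [].
apply/hasPn => s /mapP[s' _ ->]; rewrite memC /= /ovrel /=.
by apply/negP => /andP[_]; lia.
Qed.

(** * The generating series of OSOME *)

Definition weight (s : seq (nat * bool)) : int :=
  \sum_(r <- s | r.2) (-1) ^+ r.1.+1 * r.1%:Z.

(** For k >= n the enumeration lists exactly the overpartitions counted by
    OSOME, each once. *)
Lemma OSOME_ovparts n k : (n <= k)%N -> OSOME n = \sum_(s <- ovparts k n) weight s.
Proof.
move=> le_nk; have [mem un] := ovparts_spec k.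
have sumE (F : seq (nat * bool) -> int) :
    \sum_(t : n.-bseq ('I_n.+1 * bool) | is_overpartition n (decode t)) F (decode t)
    = \sum_(s <- ovparts k n) F s.
  rewrite -big_filter -(big_map (@decode n) xpredT F); apply: perm_big.
  apply: uniq_perm => //.
    by rewrite map_inj_uniq ?filter_uniq ?index_enum_uniq //; apply: decode_inj.
  move=> s; rewrite mem; apply/mapP/andP => [[t]|[os _]].
    rewrite mem_filter is_overpartitionE => /andP[os _] ->; split=> //.
    by apply: sub_all (ovseq_le os) => r h; apply: leq_trans le_nk.
  have os' := os; rewrite -is_overpartitionE in os'.
  have [t ts] := overpartition_decode os'.
  by exists t => //; rewrite mem_filter mem_index_enum ts os'.
rewrite /OSOME -!natz /OSOME_o /OSOME_e !natr_sum -sumrB -sumE.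
apply: eq_bigr => t _; rewrite !natr_sum /weight big_mkcond [X in _ - X]big_mkcond
  [RHS]big_mkcond.
rewrite -sumrB; apply: eq_bigr => -[v b] _ /=; rewrite natz.
by case: b => /=; rewrite ?subr0 // -signr_odd /=; case: (odd v) => /=; ring.
Qed.

Definition gf (F : seq (nat * bool) -> int)
    (L : nat -> seq (seq (nat * bool))) : series int :=
  fun n => \sum_(s <- L n) F s.

Definition ovplain k n := add_copies (ovparts k) k.+1 n n.

Lemma ovplainE k n : ovplain k n = ovparts k n
  ++ (if (k < n)%N then [seq (k.+1, false) :: s | s <- ovplain k (n - k.+1)] else [::]).
Proof.
rewrite {1}/ovplain; case: n => [|n] //=; case: ltnP => // le.
by rewrite add_copies_fuel //; lia.
Qed.

Definition count_gf := gf (fun=> 1).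
Definition weight_gf := gf weight.

Lemma weight_cons k b s :
  weight ((k, b) :: s) = (if b then (-1) ^+ k.+1 * k%:Z else 0) + weight s.
Proof. by rewrite /weight big_cons /=; case: b; rewrite ?add0r. Qed.

Lemma count_plain k :
  count_gf (ovplain k) = count_gf (ovparts k) + q ^+ k.+1 * count_gf (ovplain k).
Proof.
apply: serP => n; rewrite coefD monX expr1n mul1n coef_monM.
rewrite {1}/count_gf /gf ovplainE big_cat.
by congr (_ + _); case: ifP => _; rewrite ?big_nil // big_map mul1r.
Qed.

Lemma weight_plain k :
  weight_gf (ovplain k) = weight_gf (ovparts k) + q ^+ k.+1 * weight_gf (ovplain k).
Proof.
apply: serP => n; rewrite coefD monX expr1n mul1n coef_monM.
rewrite {1}/weight_gf /gf ovplainE big_cat.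
congr (_ + _); case: ifP => _; rewrite ?big_nil // big_map mul1r.
by apply: eq_bigr => s _; rewrite weight_cons add0r.
Qed.

Lemma ovpartsS k n : ovparts k.+1 n = ovplain k n
  ++ (if (k < n)%N then [seq (k.+1, true) :: s | s <- ovplain k (n - k.+1)] else [::]).
Proof. by []. Qed.

Lemma count_leS k : count_gf (ovparts k.+1) = (1 + q ^+ k.+1) * count_gf (ovplain k).
Proof.
apply: serP => n; rewrite mulrDl mul1r coefD monX expr1n mul1n coef_monM.
rewrite {1}/count_gf /gf ovpartsS big_cat.
by congr (_ + _); case: ifP => _; rewrite ?big_nil // big_map mul1r.
Qed.

Lemma weight_leS k : weight_gf (ovparts k.+1) = (1 + q ^+ k.+1) * weight_gf (ovplain k)
   + (-1) ^+ k * k.+1%:R * q ^+ k.+1 * count_gf (ovplain k).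
Proof.
have sg : (-1) ^+ k * k.+1%:R * q ^+ k.+1 = mon ((-1) ^+ k * k.+1%:Z) k.+1 :> series int.
  have -> : -1 = mon (-1) 0 :> series int.
    by apply: serP => -[|n]; rewrite coefN coef1 /mon //= oppr0.
  rewrite !monX expr1n mul1n mulrAC mon_mul mul0n add0n mulr1 mulr_natr.
  by apply: serP => n; rewrite coefMn /mon; case: eqP; rewrite ?mul0rn // -natz mulr_natr.
rewrite sg; apply: serP => n.
rewrite mulrDl mul1r !coefD monX expr1n mul1n !coef_monM.
rewrite {1}/weight_gf /gf ovpartsS big_cat -addrA.
congr (_ + _); case: ifP => _; rewrite ?big_nil ?addr0 // big_map mul1r.
under eq_bigr do rewrite weight_cons.
rewrite big_split /= addrC; congr (_ + _); rewrite mulr_sumr.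
by apply: eq_bigr => s _; rewrite mulr1 exprS exprS mulN1r mulN1r opprK.
Qed.

(** The first relation is the factor (1 + q^k) / (1 - q^k) of the generating
    product; the second is its derivative with respect to a variable that
    marks the overlined parts. *)
Lemma ovparts_step k :
  (1 - q ^+ k.+1) * count_gf (ovparts k.+1) = (1 + q ^+ k.+1) * count_gf (ovparts k) /\
  (1 - q ^+ k.+1) * weight_gf (ovparts k.+1) = (1 + q ^+ k.+1) * weight_gf (ovparts k)
      + (-1) ^+ k * k.+1%:R * q ^+ k.+1 * count_gf (ovparts k).
Proof.
have c : count_gf (ovparts k) = (1 - q ^+ k.+1) * count_gf (ovplain k).
  by rewrite mulrBl mul1r {1}count_plain addrK.
have w : weight_gf (ovparts k) = (1 - q ^+ k.+1) * weight_gf (ovplain k).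
  by rewrite mulrBl mul1r {1}weight_plain addrK.
by rewrite count_leS weight_leS c w; split; ring.
Qed.

(** Clearing the denominators turns the sum of (-1)^(k+1) k q^k / (1 + q^k)
    into the derivative of a quotient of products over odd and even k. Taking
    two steps at a time keeps both products at m factors. *)
Lemma ovparts_products m :
  count_gf (ovparts (2 * m)) * qprodn (-1) 1 1 (2 * m)
    = qprodn 1 2 1 m * qprodn 1 2 2 m /\
  weight_gf (ovparts (2 * m)) * qprodn (-1) 1 1 (2 * m)
    = theta (qprodn 1 2 1 m) * qprodn 1 2 2 m
      - qprodn 1 2 1 m * theta (qprodn 1 2 2 m).
Proof.
elim: m => [|m [IHc IHw]].
  rewrite muln0 /qprodn !big_nil theta1; split.
    apply: serP => n; rewrite !mulr1 coef1 /count_gf /gf /=.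
    by case: eqP => _; rewrite ?big_seq1 ?big_nil.
  apply: serP => n; rewrite !mulr1 mulr0 subr0 coef0 /weight_gf /gf /=.
  by case: eqP => _; rewrite ?big_seq1 ?big_nil // /weight big_nil.
have [c1 w1] := ovparts_step (2 * m).
have [c2 w2] := ovparts_step (2 * m).+1.
have -> : (2 * m.+1 = (2 * m).+2)%N by lia.
set x := q ^+ (2 * m).+1 in c1 w1; set y := q ^+ (2 * m).+2 in c2 w2.
have fN k : 1 + mon (-1) k = 1 - q ^+ k :> series int.
  congr (1 + _); apply: serP => n; rewrite coefN monX expr1n mul1n /mon.
  by case: eqP; rewrite ?oppr0.
have fP k : mon 1 k = q ^+ k :> series int by rewrite monX expr1n mul1n.
have tx : theta x = (2 * m).+1%:R * x by rewrite /x -fP theta_mon.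
have ty : theta y = (2 * m).+2%:R * y by rewrite /y -fP theta_mon.
rewrite !qprodnS.
have -> : (1 * (2 * m) + 1 = (2 * m).+1)%N by lia.
have -> : (1 * (2 * m).+1 + 1 = (2 * m).+2)%N by lia.
have -> : (2 * m + 1 = (2 * m).+1)%N by lia.
have -> : (2 * m + 2 = (2 * m).+2)%N by lia.
rewrite !fN (fP (2 * m).+1) (fP (2 * m).+2) -/x -/y.
move: IHc IHw; set Q := qprodn (-1) 1 1 (2 * m).
set o := qprodn 1 2 1 m; set e := qprodn 1 2 2 m.
move=> IHc IHw.
have sgx : (-1) ^+ (2 * m) = 1 :> series int by rewrite exprM sqrrN expr1n expr1n.
have sgy : (-1) ^+ (2 * m).+1 = -1 :> series int by rewrite exprS sgx mulr1.
rewrite sgx in w1; rewrite sgy in w2.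
split.
  transitivity (((1 - y) * count_gf (ovparts (2 * m).+2)) * (1 - x) * Q); first by ring.
  rewrite c2.
  transitivity ((1 + y) * ((1 - x) * count_gf (ovparts (2 * m).+1)) * Q); first by ring.
  rewrite c1.
  transitivity ((1 + y) * (1 + x) * (count_gf (ovparts (2 * m)) * Q)); first by ring.
  by rewrite IHc; ring.
transitivity (((1 - y) * weight_gf (ovparts (2 * m).+2)) * (1 - x) * Q); first by ring.
rewrite w2.
transitivity (((1 + y) * ((1 - x) * weight_gf (ovparts (2 * m).+1))
   - (2 * m).+2%:R * y * ((1 - x) * count_gf (ovparts (2 * m).+1))) * Q); first by ring.
rewrite c1 w1.
transitivity ((1 + y) * (1 + x) * (weight_gf (ovparts (2 * m)) * Q)
   + ((1 + y) * (2 * m).+1%:R * x - (2 * m).+2%:R * y * (1 + x))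
     * (count_gf (ovparts (2 * m)) * Q)).
  by ring.
rewrite IHc IHw !thetaM !thetaD theta1 tx ty; ring.
Qed.

Definition OSOME_series : series int := fun n => OSOME n.

(** The limit of [ovparts_products] for m going to infinity. The right side is O *
    Ev times theta log (O / Ev), and O * Ev / f1 generates overpartitions. *)
Theorem OSOME_log_derivative :
  OSOME_series * f1 = theta O * Ev - O * theta Ev.
Proof.
apply: agree_eq => N; have [_ w] := ovparts_products N.
have leN : (N <= 2 * N)%N by lia.
have aO : agree N (qprodn 1 2 1 N) O by apply: agree_qprod.
have aE : agree N (qprodn 1 2 2 N) Ev by rewrite EvE; apply: agree_qprod.
apply: agree_trans
  (_ : agree N (weight_gf (ovparts (2 * N)) * qprodn (-1) 1 1 (2 * N)) _).
  apply: agree_mul; last by apply/agree_sym/agree_qprod.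
  by move=> n lt; rewrite /OSOME_series (OSOME_ovparts (k := (2 * N)%N)) //; lia.
rewrite w; apply: agree_add; last apply: agree_opp.
  by apply: agree_mul => //; apply: agree_theta.
by apply: agree_mul => //; apply: agree_theta.
Qed.

(** In the products phi(q) = f2 O^2 and psi(q^2) = f2 Ev^2 the common factor
    disappears from the logarithmic derivative of the quotient, and what is
    left is twice that of O / Ev. *)
Theorem OSOME_four_squares : 8 * phim * OSOME_series = 1 - phim ^+ 4.
Proof.
have E1f : E1 0%N = 1 by apply: qprod0.
have p2 : psi2 = f2 * (Ev * Ev) by rewrite psiE -{1}E1_f1 !subM //; ring.
have unit0 : (f2 ^+ 2 * (O * Ev)) 0%N = 1.
  by apply: coef0M; [apply/coef0X/f2_0|rewrite -E1_split].
have key : phim ^+ 4 * (O * Ev) = O * Ev - 8 * (OSOME_series * f1).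
  apply: (series_mulI unit0); rewrite OSOME_log_derivative.
  have := four_squares.
  rewrite phiE p2 (thetaM f2 (O * O)) (thetaM f2 (Ev * Ev)).
  rewrite (thetaM O O) (thetaM Ev Ev) => e.
  transitivity (phim ^+ 4 * (f2 * (O * O) * (f2 * (Ev * Ev)))); first by ring.
  by rewrite e; ring.
have em : O * Ev * Om = 1 by rewrite -E1_split E1_Om.
have mm : Om * f1 = phim by rewrite {1}f1_split phimE; ring.
transitivity (Om * (8 * (OSOME_series * f1))); first by rewrite -mm; ring.
transitivity (Om * (O * Ev - phim ^+ 4 * (O * Ev))); first by rewrite key; ring.
transitivity (O * Ev * Om * (1 - phim ^+ 4)); first by ring.
by rewrite em mul1r.
Qed.

(** * Dissection modulo 8 *)

Lemma qXE k : qX k = q ^+ k.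
Proof. by rewrite monX expr1n mul1n. Qed.

Lemma sec_1 d j : (j < d)%N -> sec d j 1 = (j == 0%N)%:R :> series int.
Proof.
by move=> lt; rewrite -[X in sec d j X]mon0 sec_mon //; lia.
Qed.

Lemma sec4_3 (A B C D : series int) :
  sec 4 3 (sub 4 A + sub 4 B * q + sub 4 C * q ^+ 2 + sub 4 D * q ^+ 3) = D.
Proof.
rewrite !secD -!qXE !sec_subM // !sec_mon // sec_sub // sec_1 //=.
by ring.
Qed.

Lemma sec2 (A B : series int) j : (j < 2)%N ->
  sec 2 j (sub 2 A + q * sub 2 B) = if j == 0%N then A else B.
Proof.
move=> lt; rewrite secD [q * _]mulrC sec_subM // sec_mon // sec_sub // sec_1 //.
by case: j lt => [|[|j]] // _ /=; ring.
Qed.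

Section Dissection.
Variable W : series int.
Hypothesis WE : 8 * phim * W = 1 - phim ^+ 4.

(** Multiplication by phi(q) phi(q^2)^2 turns phi(-q) into phi(-q^4)^4, a
    scalar for the dissection modulo 4. The numerator is then a polynomial in
    q with coefficients in q^4. *)
Lemma sec_W43 : sec 4 3 W * phim ^+ 4 = psi2 ^+ 3 * (1 + phim ^+ 4).
Proof.
apply: (@series_intMI 8) => //.
have e1 : phim * phi * sub 2 phi ^+ 2 = sub 4 (phim ^+ 4).
  rewrite [phim * _]mulrC phi_phim -exprMn -subM // [phim * _]mulrC phi_phim.
  by rewrite subX // sub_sub // subX //; ring.
have e2 : sub 4 (phim ^+ 4) * (W *+ 8)
    = phi * sub 2 phi ^+ 2 - phim ^+ 3 * sub 4 (phim ^+ 4).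
  rewrite -e1; transitivity (8 * phim * W * (phi * sub 2 phi ^+ 2)); first by ring.
  by rewrite WE; ring.
have := congr1 (sec 4 3) e2; rewrite sec_subM //.
have e3 : sub 2 phi ^+ 2 = sub 4 phi ^+ 2 + 4 * q ^+ 2 * sub 4 psi2 ^+ 2.
  have /(congr1 (sub 2)) := phi_sq.
  by rewrite subD !subX // !subM // sub_nat // !sub_sub // sub_q // => ->; ring.
have e4 : sub 8 psi = sub 4 psi2 by rewrite sub_sub.
have -> : phi * sub 2 phi ^+ 2 - phim ^+ 3 * sub 4 (phim ^+ 4)
  = sub 4 (phi ^+ 3 * (1 - phim ^+ 4))
  + sub 4 (psi2 * phi ^+ 2 * (2 + 6 * phim ^+ 4)) * q
  + sub 4 (psi2 ^+ 2 * phi * (4 - 12 * phim ^+ 4)) * q ^+ 2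
  + sub 4 (8 * psi2 ^+ 3 * (1 + phim ^+ 4)) * q ^+ 3.
  rewrite e3 [X in X * (_ + _)]phi_even_odd [X in X ^+ 3]phim_even_odd e4.
  rewrite !subM // !subB !sub_nat // !subD !subM // !sub1 // !sub_nat // ?subX //.
  by ring.
rewrite sec4_3 raddfMn /= => E.
transitivity (phim ^+ 4 * (sec 4 3 W *+ 8)); first by ring.
by rewrite E; ring.
Qed.

(** A further multiplication by phi(q)^4 makes the denominator a series in
    q^2. *)
Lemma sec_W8 : sec 4 3 W * sub 2 (phim ^+ 8)
  = psi2 ^+ 3 * (phi ^+ 4 + sub 2 (phim ^+ 8)).
Proof.
have -> : sub 2 (phim ^+ 8) = phim ^+ 4 * phi ^+ 4.
  rewrite subX //; transitivity ((sub 2 phim ^+ 2) ^+ 4); first by ring.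
  by rewrite -phi_phim; ring.
by rewrite mulrA sec_W43; ring.
Qed.

Let splitE : psi2 ^+ 3 * (phi ^+ 4 + sub 2 (phim ^+ 8))
  = sub 2 (psi ^+ 3 * (phi ^+ 4 + 16 * q * psi2 ^+ 4 + phim ^+ 8))
    + q * sub 2 (8 * psi ^+ 7).
Proof.
rewrite {1}phi4_even_odd !subM // sub_nat // !subD !subM // !sub_nat //.
by ring.
Qed.

Lemma sec_W83 : sec 2 0 (sec 4 3 W) * phim ^+ 8
  = psi ^+ 3 * (phi ^+ 4 + 16 * q * psi2 ^+ 4 + phim ^+ 8).
Proof.
have := congr1 (sec 2 0) sec_W8.
by rewrite splitE sec2 //= [_ * sub 2 (phim ^+ 8)]mulrC sec_subM // => <-; rewrite mulrC.
Qed.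

Lemma sec_W87 : sec 2 1 (sec 4 3 W) * phim ^+ 8 = 8 * psi ^+ 7.
Proof.
have := congr1 (sec 2 1) sec_W8.
by rewrite splitE sec2 //= [_ * sub 2 (phim ^+ 8)]mulrC sec_subM // => <-; rewrite mulrC.
Qed.

End Dissection.

(** * Reduction of the coefficients *)

Definition reduce (R : comNzRingType) (f : series int) : series R := fun n => (f n)%:~R.
Arguments reduce : clear implicits.

Section Reduction.
Variable R : comNzRingType.

Lemma reduce_is_additive : zmod_morphism (reduce R).
Proof. by move=> f g; apply: serP => n; rewrite /reduce !coefB rmorphB. Qed.

Lemma reduce_is_monoid : monoid_morphism (reduce R).
Proof.
split=> [|f g]; apply: serP => n; rewrite /reduce.
  by rewrite !coef1; case: eqP.
rewrite !coefE rmorph_sum /=; apply: eq_bigr => i _.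
by rewrite rmorphM.
Qed.

HB.instance Definition _ :=
  GRing.isZmodMorphism.Build (series int) (series R) (reduce R) reduce_is_additive.
HB.instance Definition _ :=
  GRing.isMonoidMorphism.Build (series int) (series R) (reduce R) reduce_is_monoid.

Lemma reduceM f g : reduce R (f * g) = reduce R f * reduce R g.
Proof. exact: rmorphM. Qed.
Lemma reduceD f g : reduce R (f + g) = reduce R f + reduce R g.
Proof. exact: rmorphD. Qed.
Lemma reduceB f g : reduce R (f - g) = reduce R f - reduce R g.
Proof. exact: rmorphB. Qed.
Lemma reduceX f n : reduce R (f ^+ n) = reduce R f ^+ n. Proof. exact: rmorphXn. Qed.
Lemma reduce_nat n : reduce R n%:R = n%:R. Proof. exact: rmorph_nat. Qed.
Lemma reduce_qX k : reduce R (qX k) = qX k.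
Proof. by apply: serP => n; rewrite /reduce /mon; case: eqP. Qed.
Lemma reduce_theta f : reduce R (theta f) = theta (reduce R f).
Proof. by apply: serP => n; rewrite /reduce /theta rmorphMn. Qed.
Lemma reduce_sub d f : reduce R (sub d f) = sub d (reduce R f).
Proof. by apply: serP => n; rewrite /reduce /sub; case: ifP. Qed.
Lemma reduce_0 f : f 0%N = 1 -> reduce R f 0%N = 1.
Proof. by rewrite /reduce => ->. Qed.

End Reduction.

Lemma psi_0 : psi 0%N = 1.
Proof. by rewrite psiE coef_mul0 f2_0 qprod0. Qed.
Lemma psi2_0 : psi2 0%N = 1. Proof. by rewrite coef0_sub psi_0. Qed.
Lemma phi_0 : phi 0%N = 1.
Proof. by rewrite phiE !coef_mul0 f2_0 !qprod0. Qed.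
Lemma phim_0 : phim 0%N = 1.
Proof. by rewrite phimE !coef_mul0 f2_0 !qprod0. Qed.

(** Identities in characteristic n are proved by exhibiting the multiple of n
    by which the two sides differ in every commutative ring. *)
Lemma eq_natr0 (S : comNzRingType) (n : nat) (e1 e2 t : S) :
  n%:R = 0 :> S -> e1 = e2 + n%:R * t -> e1 = e2.
Proof. by move=> -> ->; rewrite mul0r addr0. Qed.

Lemma natr_series0 (R : comNzRingType) n : n%:R = 0 :> R -> n%:R = 0 :> series R.
Proof.
by move=> h; apply: serP => -[|m]; rewrite coefMn coef1 //= ?mul0rn.
Qed.

(** * Differential relations modulo 3 and 5 *)

Section ThetaODE.
Variables (R : comNzRingType) (x y z : series R).
(* x, y, z stand for phi(q), phi(-q), psi(q^2) reduced modulo a prime. *)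
Hypotheses (x0 : x 0%N = 1) (y0 : y 0%N = 1) (z0 : z 0%N = 1).
Let a := x ^+ 4.
Let c := y ^+ 4.
Let b := 16 * qX 1 * z ^+ 4.
Hypothesis abc : a - c = b.
Hypothesis squares : c * (x * z) = x * z + 4 * (x * theta z - z * theta x).

Definition logd := 4 * (theta x * sinv x).
Let al := logd.

Lemma theta_a : theta a = a * al.
Proof.
rewrite /a thetaX /al /logd.
transitivity (4 * x ^+ 3 * theta x * (x * sinv x)); last by ring.
by rewrite mul_sinv //=; ring.
Qed.

Lemma theta_b : theta b = b * (al + c).
Proof.
apply: (series_mulI x0).
rewrite /b thetaM thetaX thetaM !theta_nat theta_mon /= /al /logd.
transitivity (16 * qX 1 * z ^+ 3 * (x * z + 4 * (x * theta z))); first by ring.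
transitivity (16 * qX 1 * z ^+ 3 *
   (c * (x * z) + 4 * z * theta x * (x * sinv x))); last by ring.
by rewrite squares mul_sinv //; ring.
Qed.

Lemma theta_c : theta c = c * (al - b).
Proof.
have -> : c = a - b by rewrite -abc; ring.
rewrite thetaB theta_a theta_b -abc; ring.
Qed.

(** b is q times an invertible series once 16 is invertible, so it is not a
    zero divisor. *)
Lemma b_cancel (u : R) f : 16 * u = 1 -> b * f = 0 -> f = 0.
Proof.
move=> u16 bf; apply: (@mon_inj _ 1); rewrite mulr0.
apply: (series_mulI (coef0X 4 z0)); rewrite mulr0.
transitivity (mon (16 * u) 0 * (qX 1 * z ^+ 4 * f)).
  by rewrite u16 mon0; ring.
have -> : mon (16 * u) 0 = 16 * mon u 0.
  by apply: serP => n; rewrite !mulr_natl coefMn /mon; case: eqP; rewrite ?mul0rn.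
by transitivity (mon u 0 * (b * f)); [rewrite /b; ring|rewrite bf mulr0].
Qed.

(** Modulo 3, theta phi^4 = phi^3 theta phi, so a and c inherit theta^2 a =
    theta a from phi. Written with logarithmic derivatives, the two equations
    differ by b (b - c + 1). *)
Lemma ode_mod3 : 3 = 0 :> R ->
    theta (theta x) = theta x -> theta (theta y) = theta y ->
  a + b = 1.
Proof.
move=> R3 xx yy; have h3 : 3 = 0 :> series R by exact: natr_series0.
have dd (u : series R) : theta (theta u) = theta u ->
    theta (theta (u ^+ 4)) = theta (u ^+ 4).
  move=> uu; rewrite thetaX thetaM uu thetaM thetaX theta_nat /=.
  by apply: (eq_natr0 (t := 4 * u ^+ 2 * theta u ^+ 2) h3); ring.
have ea : al ^+ 2 + theta al = al.
  apply: (series_mulI (coef0X 4 x0)); have := dd x xx.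
  by rewrite -/a theta_a thetaM theta_a => <-; ring.
have ec : (al - b) ^+ 2 + (theta al - b * (al + c)) = al - b.
  apply: (series_mulI (coef0X 4 y0)); have := dd y yy.
  by rewrite -/c theta_c thetaM theta_c thetaB theta_b => <-; ring.
have key : b * (b - c + 1) = 0.
  apply: (eq_natr0 (t := al * b) h3).
  transitivity (((al - b) ^+ 2 + (theta al - b * (al + c)) - (al - b))
               - (al ^+ 2 + theta al - al) + 3 * (al * b)); first by ring.
  by rewrite ea ec; ring.
have u16 : 16 * 1 = 1 :> R.
  by apply: (eq_natr0 (t := 5) R3); ring.
have bc := b_cancel u16 key.
apply: (eq_natr0 (t := b) h3).
transitivity (1 + 3 * b - (b - c + 1) + (a - c - b)); first by ring.
by rewrite bc abc; ring.
Qed.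

Section Mod5.
Hypothesis R5 : 5 = 0 :> R.
Hypothesis squares_mod2 : x * y = sub 2 y ^+ 2.
Hypotheses (x3 : theta (theta (theta x)) = theta x)
           (y3 : theta (theta (theta y)) = theta y).

Let h5 : 5 = 0 :> series R.
Proof. exact: natr_series0. Qed.

Let u16 : 16 * 1 = 1 :> R.
Proof. by apply: (eq_natr0 (t := 3) R5); ring. Qed.

Let aE : a = b + c. Proof. by rewrite -abc; ring. Qed.

Let theta_diff : theta (al - b) = theta al - b * (al + c).
Proof. by rewrite thetaB theta_b. Qed.

Let theta2_diff : theta (theta (al - b))
  = theta (theta al) - (b * (al + c) ^+ 2 + b * (theta al + c * (al - b))).
Proof. by rewrite theta_diff thetaB thetaM theta_b thetaD theta_c; ring. Qed.

(** Modulo 5, phi is a constant times 1 / a, so 1 / a satisfies theta^3 v =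
    theta v, a second order equation for the logarithmic derivative; the same
    holds for c. In the difference of the two the second derivatives cancel
    and b factors out. *)
Lemma riccati_a : 2 * theta al = al ^+ 2 + a ^+ 2 - 1.
Proof.
have riccati (u l : series R) : u 0%N = 1 -> theta (theta (theta u)) = theta u ->
    theta (u ^+ 4) = u ^+ 4 * l ->
    - l ^+ 3 + 3 * l * theta l - theta (theta l) = - l.
  move=> u0 u3 ul; pose v := sinv (u ^+ 4).
  have uv : u ^+ 4 * v = 1 by apply/mul_sinv/coef0X.
  have v1 : theta v = - v * l.
    apply: (series_mulI (coef0X 4 u0)).
    have := congr1 (@theta R) uv; rewrite thetaM theta1 ul => e.
    transitivity (u ^+ 4 * l * v + u ^+ 4 * theta v - u ^+ 4 * l * v); first by ring.
    by rewrite e; ring.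
  (* u is the constant u^5 times the inverse v of u^4. *)
  have w5 : theta (u ^+ 5) = 0.
    by rewrite thetaX; apply: (eq_natr0 (t := u ^+ 4 * theta u) h5) => /=; ring.
  have uE : u = u ^+ 5 * v.
    by transitivity (u * (u ^+ 4 * v)); [rewrite uv mulr1|ring].
  have v3 : theta (theta (theta v)) = theta v.
    apply: (series_mulI (coef0X 5 u0)).
    have t5 f : theta (u ^+ 5 * f) = u ^+ 5 * theta f.
      by rewrite thetaM w5 mul0r add0r.
    by rewrite -!t5 -uE.
  have v0 : v 0%N = 1.
    have := congr1 (fun f => f 0%N) uv.
    by rewrite coef_mul0 coef0X // mul1r => ->.
  apply: (series_mulI v0); rewrite mulrN -mulNr -v1 -v3 v1.
  by rewrite !(thetaM, thetaN, thetaD, v1); ring.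
have ea := riccati x al x0 x3 theta_a.
have := riccati y (al - b) y0 y3 theta_c.
rewrite theta2_diff theta_diff => ec.
apply/subr0_eq/(b_cancel u16).
transitivity ((- al ^+ 3 + 3 * al * theta al - theta (theta al) + al)
  - (- (al - b) ^+ 3 + 3 * (al - b) * (theta al - b * (al + c))
     - (theta (theta al) - (b * (al + c) ^+ 2 + b * (theta al + c * (al - b))))
     + (al - b))); first by rewrite aE; ring.
by rewrite ea ec; ring.
Qed.

Lemma riccati_c : 2 * theta (al - b) = (al - b) ^+ 2 + c ^+ 2 - 1.
Proof.
rewrite theta_diff; transitivity (2 * theta al - 2 * b * (al + c)); first by ring.
by rewrite riccati_a aE; ring.
Qed.

(** The Riccati equation for c holds at q^2 as well, and phi(-q^2)^8 = a c
    expresses everything there through a, b, c at q. The logarithmic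
    derivatives combine to a square that reduces to b^2. *)
Lemma quadric_mod5 : a ^+ 2 - a * b + b ^+ 2 = 1.
Proof.
pose g := sub 2 (al - b); pose d := sub 2 c.
have dE : d = x ^+ 2 * y ^+ 2.
  rewrite /d /c subX //; transitivity ((sub 2 y ^+ 2) ^+ 2); first by ring.
  by rewrite -squares_mod2; ring.
have ddE : d ^+ 2 = a * c by rewrite dE /a /c; ring.
have gE : theta g = g ^+ 2 + d ^+ 2 - 1.
  have := congr1 (sub 2) riccati_c.
  rewrite subM // sub_nat // subB subD sub1 // (subX (al - b)) // (subX c) // => <-.
  by rewrite theta_sub //; ring.
have thd : theta d = 2 * d * g.
  by rewrite theta_sub // theta_c subM // -/d -/g; ring.
have g4 : 4 * g = al + (al - b).
  apply: (series_mulI (f := a * c)); first exact: coef0M (coef0X 4 x0) (coef0X 4 y0).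
  transitivity (theta (d ^+ 2)); first by rewrite thetaX thd -ddE /=; ring.
  by rewrite ddE thetaM theta_a theta_c; ring.
have th4 : 4 * theta g = theta al + theta (al - b).
  have := congr1 (@theta R) g4; rewrite thetaM theta_nat mul0r add0r => ->.
  by rewrite thetaD.
have key : (al - (al - b)) ^+ 2 + 2 * a ^+ 2 + 2 * c ^+ 2 - 16 * (a * c) + 12 = 0.
  transitivity (2 * (al ^+ 2 + a ^+ 2 - 1 + ((al - b) ^+ 2 + c ^+ 2 - 1))
    - ((al + (al - b)) ^+ 2 + 16 * (a * c) - 16)); first by ring.
  rewrite -riccati_a -riccati_c -g4 -ddE.
  transitivity (4 * (theta al + theta (al - b))
                - 16 * (g ^+ 2 + d ^+ 2 - 1)); first by ring.
  by rewrite -th4 gE; ring.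
apply: (eq_natr0 (t := 5 * a ^+ 2 - 5 * a * b - b ^+ 2 - 5) h5).
transitivity (1 + 2 * ((al - (al - b)) ^+ 2 + 2 * a ^+ 2 + 2 * c ^+ 2
    - 16 * (a * c) + 12) + 5 * (5 * a ^+ 2 - 5 * a * b - b ^+ 2 - 5)).
  by rewrite aE; ring.
by rewrite key; ring.
Qed.

Let one_ab : 1 - a * b = c ^+ 2.
Proof. by rewrite -quadric_mod5 aE; ring. Qed.

(** Obtained by differentiating the quadratic relation. *)
Lemma log_deriv_mod5 : 2 * al = b * c * (a - 2 * b).
Proof.
have := congr1 (@theta R) quadric_mod5.
rewrite thetaD thetaB (thetaX a) (thetaX b) (thetaM a b) theta_a theta_b theta1 /= => e.
transitivity (2 * al * (a ^+ 2 - a * b + b ^+ 2)); first by rewrite quadric_mod5; ring.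
transitivity ((2 * a ^+ 1 * (a * al) - (a * al * b + a * (b * (al + c))) +
   2 * b ^+ 1 * (b * (al + c))) + b * c * (a - 2 * b)); first by ring.
by rewrite e; ring.
Qed.

Lemma theta_ab_mod5 : theta (a * b) = a * b * (a + b) * c ^+ 2.
Proof.
rewrite thetaM theta_a theta_b.
transitivity (a * b * (2 * al + c)); first by ring.
rewrite log_deriv_mod5.
transitivity (a * b * c * (b * (a - 2 * b) + (a ^+ 2 - a * b + b ^+ 2))).
  by rewrite quadric_mod5; ring.
by rewrite aE; ring.
Qed.

Let w := c ^+ 2.
Let v := sinv w.
Let vw : v * w = 1.
Proof. by rewrite mulrC; apply/mul_sinv/coef0X/coef0X. Qed.

Let ab_w : a * b = 1 - w. Proof. by rewrite /w -one_ab; ring. Qed.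

Let theta_w : theta w = - ((1 - w) * w * (a + b)).
Proof.
have -> : theta w = - theta (a * b) by rewrite ab_w thetaB theta1; ring.
by rewrite theta_ab_mod5 ab_w -/w; ring.
Qed.

Let theta_v : theta v = (v - 1) * (a + b).
Proof.
have := congr1 (@theta R) vw; rewrite thetaM theta1 theta_w => e.
transitivity (v * (theta v * w + v * - ((1 - w) * w * (a + b)))
   + (1 - v * w) * theta v + v * w * (v - v * w) * (a + b)).
  by ring.
by rewrite e vw; ring.
Qed.

Let sum_sq : (a + b) ^+ 2 = 4 - 3 * w.
Proof.
transitivity (a ^+ 2 - a * b + b ^+ 2 + 3 * (a * b)); first by ring.
by rewrite quadric_mod5 ab_w; ring.
Qed.

Let theta_sum : 2 * theta (a + b) = 3 * (1 - w) * w.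
Proof.
rewrite thetaD theta_a theta_b.
transitivity (2 * al * (a + b) + 2 * b * c); first by ring.
rewrite log_deriv_mod5 -ab_w.
transitivity (b * c * ((a - 2 * b) * (a + b) + 2 * (a ^+ 2 - a * b + b ^+ 2))).
  by rewrite quadric_mod5; ring.
by rewrite /w aE; ring.
Qed.

(** By the previous formulas theta^2 w = w^2 - w and theta^2 v = 2 - v - w^2,
    where w = c^2 and v = 1 / w. *)
Lemma oscillator_mod5 : theta (theta (w + v)) + (w + v) = 2.
Proof.
have u3 (f g : series R) : 2 * f = 2 * g -> f = g.
  move=> e; apply: (eq_natr0 (t := g - f) h5).
  transitivity (3 * (2 * f) - 5 * f); first by ring.
  by rewrite e; ring.
apply: u3; rewrite !(thetaD w v) theta_w theta_v.
have h1 : theta ((1 - w) * w * (a + b))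
  = - (1 - 2 * w) * (1 - w) * w * (a + b) ^+ 2 + (1 - w) * w * theta (a + b).
  by rewrite (thetaM ((1 - w) * w)) (thetaM (1 - w)) (thetaB 1) theta1 theta_w; ring.
have h2 : theta ((v - 1) * (a + b))
  = (v - 1) * (a + b) ^+ 2 + (v - 1) * theta (a + b).
  by rewrite thetaM (thetaB v) theta1 theta_v; ring.
rewrite thetaD thetaN h1 h2.
transitivity (2 * (1 - 2 * w) * (1 - w) * w * (a + b) ^+ 2
  - (1 - w) * w * (2 * theta (a + b))
  + 2 * (v - 1) * (a + b) ^+ 2 + (v - 1) * (2 * theta (a + b)) + 2 * (w + v)).
  by ring.
rewrite theta_sum.
transitivity ((2 * (1 - 2 * w) * (1 - w) * w + 2 * (v - 1)) * (a + b) ^+ 2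
   - 3 * (1 - w) ^+ 2 * w ^+ 2 + (v - 1) * (3 * (1 - w) * w) + 2 * (w + v)); first by ring.
rewrite sum_sq.
pose t := 2 * v - 3 + 2 * w - 6 * w ^+ 2 + 8 * w ^+ 3 - 3 * w ^+ 4.
apply: (eq_natr0 (t := t) h5).
transitivity (2 * 2 + 5 * t + 3 * (1 - v * w) * (1 + w)); first by rewrite /t; ring.
by rewrite vw; ring.
Qed.

(** The left side is 16 q psi^5 times the series of the coefficients in the
    class 3 modulo 8. *)
Lemma target_mod5 : a * b * ((a + b) * v + 1) = 1 - w + theta v.
Proof.
rewrite theta_v ab_w.
transitivity (1 - w + (v - v * w) * (a + b)); first by ring.
by rewrite vw; ring.
Qed.

End Mod5.

End ThetaODE.

(** * Residue classes of exponents modulo a prime *)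

Definition vanishes (R : comNzRingType) (p k : nat) (f : series R) :=
  forall n, (n %% p = k)%N -> f n = 0.

Section Classes.
Variables (R : fieldType) (p : nat).
Hypothesis pR : p \in [pchar R].

Implicit Types f g h : series R.

(** The coefficient of q^n in theta f is n times that of f, and n is
    invertible modulo p unless p divides it. *)
Lemma theta0_supp f n : theta f = 0 -> ~~ (p %| n)%N -> f n = 0.
Proof.
move=> /(congr1 (fun h => h n)); rewrite coef0 /theta -mulr_natr => /eqP.
by rewrite mulf_eq0 -(dvdn_pcharf pR) => /orP[/eqP|->].
Qed.

(** A factor killed by theta has only exponents divisible by p, hence does not
    move exponents between classes. *)
Lemma vanishes_mul k h f : theta h = 0 -> vanishes p k f -> vanishes p k (h * f).
Proof.
move=> th vf n nk; rewrite coefE big1 // => i _.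
have [/dvdnP[j ij]|ni] := boolP (p %| i)%N; last by rewrite (theta0_supp th ni) mul0r.
rewrite vf ?mulr0 // -nk; have le : (i <= n)%N by rewrite -ltnS.
by rewrite -[in RHS](subnK le) ij addnC modnMDl.
Qed.

Lemma vanishesD k f g : vanishes p k f -> vanishes p k g -> vanishes p k (f + g).
Proof. by move=> vf vg n nk; rewrite coefD vf ?vg ?addr0. Qed.

Lemma vanishes1 k : (0 < k)%N -> vanishes p k (1 : series R).
Proof. by move=> k0 [|n] //; rewrite mod0n => e; rewrite -e in k0. Qed.

Lemma theta_pow f n : (p %| n)%N -> theta (f ^+ n) = 0.
Proof.
rewrite (dvdn_pcharf pR) => /eqP /natr_series0 n0.
by rewrite thetaX n0 !mul0r.
Qed.

Lemma theta_sinv (h : series R) : h 0%N = 1 -> theta h = 0 -> theta (sinv h) = 0.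
Proof.
move=> h0 th; apply: (series_mulI h0).
by have := congr1 (@theta R) (mul_sinv h0); rewrite thetaM th mul0r add0r theta1 mulr0.
Qed.

Lemma vanishes_cancel k h f : h 0%N = 1 -> theta h = 0 ->
  vanishes p k (h * f) -> vanishes p k f.
Proof.
move=> h0 th /(vanishes_mul (theta_sinv h0 th)).
by rewrite mulrA [sinv h * h]mulrC mul_sinv // mul1r.
Qed.

Lemma natr_fermat k : (k%:R : R) ^+ p = k%:R.
Proof. by rewrite -(pFrobenius_autE pR) pFrobenius_aut_nat. Qed.

End Classes.

Lemma phi_sg_supp s n : (forall k, k * k <> n)%N -> phi_sg s n = 0.
Proof.
move=> nk; rewrite phi_sg.unlock /qsumz coefD !qsum_supp ?addr0 // => t.
  by move=> /nk.
by move=> /nk.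
Qed.

Section Congruences.
Variable W : series int.
Hypothesis WE : 8 * phim * W = 1 - phim ^+ 4.
Let W83 := sec 2 0 (sec 4 3 W).
Let W87 := sec 2 1 (sec 4 3 W).

Section Red.
Variable R : comNzRingType.

Lemma reduce_diff :
  reduce R phi ^+ 4 - reduce R phim ^+ 4 = 16 * qX 1 * reduce R psi2 ^+ 4.
Proof.
have := congr1 (reduce R) phi4_diff.
by rewrite reduceB !reduceX reduceM reduceX reduceM reduce_nat reduce_qX.
Qed.

Lemma reduce_squares : reduce R phim ^+ 4 * (reduce R phi * reduce R psi2)
  = reduce R phi * reduce R psi2 + 4 * (reduce R phi * theta (reduce R psi2)
      - reduce R psi2 * theta (reduce R phi)).
Proof.
have := congr1 (reduce R) four_squares.
by rewrite reduceM reduceX reduceD !reduceM reduceB !reduceM reduce_nat !reduce_theta.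
Qed.

Lemma reduce_W83 : reduce R W83 * reduce R phim ^+ 8
  = reduce R psi ^+ 3
    * (reduce R phi ^+ 4 + 16 * qX 1 * reduce R psi2 ^+ 4 + reduce R phim ^+ 8).
Proof.
have := congr1 (reduce R) (sec_W83 WE).
rewrite reduceM reduceX reduceM reduceX !reduceD !reduceX.
by rewrite reduceM reduceX reduceM reduce_nat reduce_qX.
Qed.

End Red.

Lemma coef_mod3 n : (W (24 * n + 19)%N = 0 %[mod 3])%Z.
Proof.
pose R := 'F_3; have pR : 3%N \in [pchar R] by apply: pchar_Fp.
have R3 : 3 = 0 :> R by apply/val_inj.
have sq s : theta (theta (reduce R (phi_sg s))) = theta (reduce R (phi_sg s)).
  apply: serP => m; rewrite /theta /reduce.
  have [[k km]|nk] := EM (exists k, k * k = m)%N; last first.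
    by rewrite phi_sg_supp ?mul0rn // => k km; apply: nk; exists k.
  rewrite -km -mulrnA -[LHS]mulr_natr -[RHS]mulr_natr !natrM; congr (_ * _).
  transitivity ((k%:R : R) ^+ 3 * k%:R); first by ring.
  by rewrite natr_fermat.
have ab1 := ode_mod3 (reduce_0 R phi_0) (reduce_0 R phim_0) (reduce_0 R psi2_0)
  (reduce_diff R) (reduce_squares R) R3 (sq 1) (sq (-1)).
have y0 := reduce_0 R phim_0.
have v : vanishes 3 2 (reduce R W83).
  apply: (vanishes_cancel pR (coef0X 9 y0) (theta_pow pR _ _)) => //.
  have -> : reduce R phim ^+ 9 * reduce R W83
      = reduce R psi ^+ 3 * reduce R phim + reduce R psi ^+ 3 * reduce R phim ^+ 9 * 1.
    transitivity (reduce R phim * (reduce R W83 * reduce R phim ^+ 8)); first by ring.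
    by rewrite reduce_W83 ab1; ring.
  have tp (f : series R) k : theta (f ^+ (3 * k)) = 0.
    by apply: (theta_pow pR); apply: dvdn_mulr.
  apply: vanishesD; apply: (vanishes_mul pR).
  - exact: (tp _ 1%N).
  - move=> m m2; rewrite /reduce phi_sg_supp // => k km.
    move: m2; rewrite -km -modnMm.
    by case: (k %% 3)%N (ltn_pmod k (isT : 0 < 3)%N) => [|[|[|]]].
  - by rewrite thetaM (tp _ 1%N) (tp _ 3) mul0r mulr0 addr0.
  - exact: vanishes1.
apply/eqP; rewrite eqz_mod_dvd subr0 (dvdz_pcharf pR).
have n2 : ((3 * n + 2) %% 3 = 2)%N by rewrite mulnC modnMDl.
have := v _ n2; rewrite /reduce /W83 /sec => e; apply/eqP.
by rewrite -[RHS]e; congr (W _)%:~R; lia.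
Qed.

Lemma coef_mod5 n : (W (40 * n + 27)%N = 0 %[mod 5])%Z.
Proof.
pose R := 'F_5; have pR : 5%N \in [pchar R] by apply: pchar_Fp.
have R5 : 5 = 0 :> R by apply/val_inj.
have sq s : theta (theta (theta (reduce R (phi_sg s)))) = theta (reduce R (phi_sg s)).
  apply: serP => m; rewrite /theta /reduce.
  have [[k km]|nk] := EM (exists k, k * k = m)%N; last first.
    by rewrite phi_sg_supp ?mul0rn // => k km; apply: nk; exists k.
  rewrite -km -!mulrnA -[LHS]mulr_natr -[RHS]mulr_natr !natrM; congr (_ * _).
  transitivity ((k%:R : R) ^+ 5 * k%:R); first by ring.
  by rewrite natr_fermat.
have x0 := reduce_0 R phi_0; have y0 := reduce_0 R phim_0; have z0 := reduce_0 R psi2_0.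
have p0 := reduce_0 R psi_0.
have xy : reduce R phi * reduce R phim = sub 2 (reduce R phim) ^+ 2.
  by rewrite -reduce_sub -reduceM phi_phim reduceX.
have xz : reduce R phi * reduce R psi2 = reduce R psi ^+ 2.
  by rewrite -reduceM phi_sub_psi reduceX.
have osc := oscillator_mod5 x0 y0 z0 (reduce_diff R) (reduce_squares R) R5 xy
  (sq 1) (sq (-1)).
have tgt := target_mod5 x0 y0 z0 (reduce_diff R) (reduce_squares R) R5 xy
  (sq 1) (sq (-1)).
set w := (reduce R phim ^+ 4) ^+ 2 in osc tgt; set v := sinv w in osc tgt.
set u := reduce R psi; set s := reduce R phi ^+ 4 + 16 * qX 1 * reduce R psi2 ^+ 4 in tgt.
have wv : w * v = 1 by apply/mul_sinv/coef0X/coef0X.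
have wE : reduce R phim ^+ 8 = w by rewrite /w; ring.
have W83E : reduce R W83 = u ^+ 3 * (s * v + 1).
  transitivity (reduce R W83 * reduce R phim ^+ 8 * v).
    by rewrite -[RHS]mulrA wE wv mulr1.
  rewrite reduce_W83 wE -/s -/u.
  transitivity (u ^+ 3 * (s * v + w * v)); first by ring.
  by rewrite wv.
have G : qX 1 * (u ^+ 5 * reduce R W83) = 1 - w + theta v.
  rewrite -tgt W83E.
  apply: (eq_natr0 (n := 5) (t := - 3 * qX 1 * u ^+ 8 * (s * v + 1))).
    exact: natr_series0.
  transitivity (16 * qX 1 * (reduce R phi * reduce R psi2) ^+ 4 * (s * v + 1)
                + 5 * (- 3 * qX 1 * u ^+ 8 * (s * v + 1))); last by ring.
  by rewrite xz; ring.
have v5 : vanishes 5 3 (reduce R W83).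
  apply: (vanishes_cancel pR (coef0X 5 p0) (theta_pow pR _ _)) => // m m3.
  have := congr1 (fun f => f m.+1) G; rewrite coef_monM /= subn1 mul1r /= => ->.
  have := congr1 (fun f => f m.+1) osc; rewrite /theta !coefD coefN coef1 /=.
  (* The factor q shifts the class 3 to 4. *)
  have m4 : m.+1%:R = 4 :> R.
    by rewrite (divn_eq m 5) m3 -natr1 natrD natrM R5 mulr0 add0r natr1.
  have -> : (2 : series R) m.+1 = 0 by rewrite coefMn coef1 mul0rn.
  have m4' (y : R) : y *+ m.+1 = 4 * y by rewrite -[LHS]mulr_natl m4.
  rewrite !m4' => e.
  apply: (eq_natr0 (n := 5) (t := - 7 * w m.+1 - 6 * v m.+1) R5).
  transitivity (2 * (4 * (4 * (w m.+1 + v m.+1)) + (w m.+1 + v m.+1))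
                + 5 * (- 7 * w m.+1 - 6 * v m.+1)); first by ring.
  by rewrite e; ring.
apply/eqP; rewrite eqz_mod_dvd subr0 (dvdz_pcharf pR).
have n3 : ((5 * n + 3) %% 5 = 3)%N by rewrite mulnC modnMDl.
have := v5 _ n3; rewrite /reduce /W83 /sec => e; apply/eqP.
by rewrite -[RHS]e; congr (W _)%:~R; lia.
Qed.

Lemma coef_mod8 n : (W (8 * n + 7)%N = 0 %[mod 8])%Z.
Proof.
have c0 : (phim ^+ 8) 0%N = 1 by apply/coef0X/phim_0.
have := sec_W87 WE; set v := sinv (phim ^+ 8) => e.
have E : sec 2 1 (sec 4 3 W) = (psi ^+ 7 * v) *+ 8.
  apply: (series_mulI c0); rewrite mulrC e.
  transitivity (8 * psi ^+ 7 * (phim ^+ 8 * v)); last by ring.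
  by rewrite mul_sinv // mulr1.
have -> : W (8 * n + 7)%N = sec 2 1 (sec 4 3 W) n by rewrite /sec; congr W; lia.
by apply/eqP; rewrite eqz_mod_dvd subr0 E coefMn -[X in (_ %| X)%Z]mulr_natr dvdz_mull.
Qed.

End Congruences.

(** * The seventh power of the cube of Euler's product modulo 11 *)

Section Grading.
Variables (R : comNzRingType) (p : nat).
Hypothesis p0 : (0 < p)%N.
Implicit Types f g : series R.

Definition residue_part (k : nat) f : series R :=
  fun n => if (n %% p == k)%N then f n else 0.

Lemma residue_part0 k f : vanishes p k f -> residue_part k f = 0.
Proof.
by move=> v; apply: serP => n; rewrite /residue_part coef0; case: eqP => // /v.
Qed.

Lemma residue_partM k f g : (k < p)%N ->
  residue_part k (f * g)
    = \sum_(i < p) residue_part i f * residue_part ((k + (p - i)) %% p) g.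
Proof.
move=> kp; apply: serP => n; rewrite coef_sum /residue_part.
under [RHS]eq_bigr => i _ do rewrite coefE.
rewrite exchange_big /=.
have -> : (if (n %% p == k)%N then (f * g) n else 0)
  = \sum_(j < n.+1) (if (n %% p == k)%N then f j * g (n - j)%N else 0).
  by case: eqP => // _; rewrite big1.
apply: eq_bigr => j _; have jp : (j %% p < p)%N by rewrite ltn_mod.
rewrite (bigD1 (Ordinal jp)) //= eqxx big1 ?addr0 => [|i]; last first.
  by rewrite -val_eqE /= eq_sym => /negPf ->; rewrite mul0r.
have jn : (j <= n)%N by rewrite -ltnS.
have ej : ((k + (p - j %% p) + j) %% p = k)%N.
  have -> : (k + (p - j %% p) + j = (j %/ p).+1 * p + k)%N.
    by have := divn_eq j p; rewrite mulSn; lia.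
  by rewrite modnMDl modn_small.
have -> : ((n - j) %% p == (k + (p - j %% p)) %% p)%N = (n %% p == k)%N.
  by rewrite -(eqn_modDr j) subnK // ej.
by case: eqP; rewrite ?mulr0.
Qed.

Lemma vanishes_residue_part k f : residue_part k f = 0 -> vanishes p k f.
Proof.
move=> /(congr1 (fun h => h _)) e n nk; have := e n.
by rewrite /residue_part nk eqxx coef0.
Qed.

End Grading.

Section Polynomial11.
Variables (S : comNzRingType).
Implicit Types t s r u v : S.

(** The part of (x1 + ... + x5)^4 in one residue class, halved, for variables
    of classes 0, 1, 3, 6, 10 modulo 11. These classes are permuted cyclically
    by an affine map, and the five missing classes of the fourth power
    correspond to the five cyclic arrangements of (t, s, r, u, v). *)
Definition quartic t s r u v : S :=
  2 * r * s ^+ 3 + 2 * r ^+ 3 * u + 2 * t * v ^+ 3 + 3 * s ^+ 2 * t ^+ 2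
  + 6 * t ^+ 2 * u * v + 12 * r * s * u * v.

(** Once the vanishing classes of the fourth power are dropped, the part of
    class 6 of the seventh power is the sum of 11 * septic - cofactor *
    quartic over the five arrangements. The coefficients come from solving
    linear equations over the field with 11 elements and lifting the solution
    to the integers. *)
Definition cofactor t s r u v : S := 9 * r ^+ 2 * u + 4 * s ^+ 3 + 14 * s * u * v.

Definition septic t s r u v : S :=
  r ^+ 6 * t + 3 * r ^+ 5 * u ^+ 2 + 22 * r ^+ 4 * s * t * v
  + 14 * r ^+ 3 * s ^+ 3 * u + 44 * r ^+ 3 * s * u ^+ 2 * v
  + 63 * r ^+ 2 * s ^+ 2 * u * t ^+ 2.

End Polynomial11.

Section Mod11.
Variable R : comNzRingType.
Hypothesis R11 : 11 = 0 :> R.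
Variable J : series R.
Hypothesis Jsupp : forall k, k \in [:: 2; 4; 5; 7; 8; 9]%N -> vanishes 11 k J.
Hypothesis J4supp : forall k, k \in [:: 3; 6; 8; 9; 10]%N -> vanishes 11 k (J ^+ 4).

(** J^7 = J^4 J^3. Only six classes of J^4 are present, and each is a
    quadratic expression in the classes of J^2; the resulting polynomial in
    the five parts of J lies in the ideal generated by 11 and the five
    quartics. *)
Lemma seventh_power_mod11 : vanishes 11 6 (J ^+ 7).
Proof.
pose P k f := @residue_part R 11 k f.
pose a := P 0 J; pose b := P 1 J; pose c := P 3 J; pose d := P 6 J; pose e := P 10 J.
have PJ k : (k < 11)%N -> P k J = nth 0 [:: a; b; 0; c; 0; 0; d; 0; 0; 0; e] k.
  by do 11?[case: k => [|k] //=] => _; apply/residue_part0/Jsupp.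
have PM k f g : (k < 11)%N ->
    P k (f * g) = \sum_(i < 11) P i f * P ((k + (11 - i)) %% 11)%N g.
  exact: residue_partM.
have P2 k : (k < 11)%N -> P k (J * J) = nth 0
   [:: a ^+ 2 + 2 * b * e; 2 * a * b + d ^+ 2; b ^+ 2 + 2 * c * e; 2 * a * c;
       2 * b * c; 2 * d * e; 2 * a * d + c ^+ 2; 2 * b * d; 0;
       2 * c * d + e ^+ 2; 2 * a * e] k.
  do 11?[case: k => [|k] /=]; move=> // _;
    rewrite PM // !big_ord_recr big_ord0 /= !PJ //=; ring.
have h11 : 11 = 0 :> series R by exact: natr_series0.
have P4 k : k \in [:: 3; 6; 8; 9; 10]%N -> P k (J * J * (J * J)) = 0.
  have -> : J * J * (J * J) = J ^+ 4 by ring.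
  by move=> /J4supp; apply: residue_part0.
(* 2 is inverted by 6 modulo 11. *)
have half (x y : series R) : y = 0 -> y = 2 * x -> x = 0.
  move=> -> e0; apply: (eq_natr0 (t := - x) h11).
  by transitivity (6 * (2 * x) - 11 * x); [ring|rewrite -e0; ring].
have Q3 : quartic d b a c e = 0.
  apply: half (P4 3%N isT) _; rewrite PM // !big_ord_recr big_ord0 /= !P2 //=.
  by rewrite /quartic; ring.
have Q6 : quartic c a d e b = 0.
  apply: half (P4 6%N isT) _; rewrite PM // !big_ord_recr big_ord0 /= !P2 //=.
  by rewrite /quartic; ring.
have Q8 : quartic b c e a d = 0.
  apply: half (P4 8%N isT) _; rewrite PM // !big_ord_recr big_ord0 /= !P2 //=.
  by rewrite /quartic; ring.
have Q9 : quartic a e b d c = 0.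
  apply: half (P4 9%N isT) _; rewrite PM // !big_ord_recr big_ord0 /= !P2 //=.
  by rewrite /quartic; ring.
have Q10 : quartic e d c b a = 0.
  apply: half (P4 10%N isT) _; rewrite PM // !big_ord_recr big_ord0 /= !P2 //=.
  by rewrite /quartic; ring.
apply: vanishes_residue_part; rewrite -/(P _ _).
have -> : J ^+ 7 = J * J * (J * J) * (J * J * J) by ring.
rewrite PM // !big_ord_recr big_ord0 /=.
rewrite !(P4 3, P4 6, P4 8, P4 9, P4 10) // !mul0r !add0r !addr0.
rewrite !(PM _ (J * J)) // !big_ord_recr !big_ord0 /= !P2 // !PJ //=.
apply: (eq_natr0 h11 (t := septic d b a c e
      + septic c a d e b
      + septic b c e a d
      + septic a e b d c
      + septic e d c b a)).
transitivity (11 * (septic d b a c e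
      + septic c a d e b
      + septic b c e a d
      + septic a e b d c
      + septic e d c b a)
  - (cofactor d b a c e * quartic d b a c e
      + cofactor c a d e b * quartic c a d e b
      + cofactor b c e a d * quartic b c e a d
      + cofactor a e b d c * quartic a e b d c
      + cofactor e d c b a * quartic e d c b a)).
  by rewrite /septic /cofactor /quartic; ring.
by rewrite Q3 Q6 Q8 Q9 Q10 !mulr0 !addr0 subr0 add0r.
Qed.
End Mod11.

(** * The congruence modulo 11 *)

Theorem pentagonal :
  f1 = qsum (fun t => (-1) ^+ t) (fun t => 3 * 'C(t, 2) + 1 * t)%N
      + qsum (fun i => (-1) ^+ i.+1) (fun i => 3 * 'C(i.+1, 2) + 2 * i.+1)%N.
Proof.
rewrite -triple_product // [LHS](qprod_split (d := 3)) // !big_ord_recr big_ord0 /=.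
by rewrite mul1r mulrC.
Qed.

Lemma all_mod11 (P : nat -> nat -> bool) n t :
  all (fun m => all (P m) (iota 0 11)) (iota 0 11) -> P (n %% 11)%N (t %% 11)%N.
Proof.
have mem k : (k %% 11)%N \in iota 0 11 by rewrite mem_iota ltn_mod.
by move=> /allP /(_ _ (mem n)) /allP /(_ _ (mem t)).
Qed.

Lemma modn_quad d a b t :
  ((a * t * t + b * t) %% d = (a * (t %% d) * (t %% d) + b * (t %% d)) %% d)%N.
Proof.
rewrite {1 2 3}(divn_eq t d); set u := (t %/ d)%N; set r := (t %% d)%N.
have -> : (a * (u * d + r) * (u * d + r) + b * (u * d + r)
  = (a * u * (u * d + 2 * r) + b * u) * d + (a * r * r + b * r))%N by ring.
by rewrite modnMDl.
Qed.

Lemma modn_lin d a b n t :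
  ((a * n + b * t) %% d = (a * (n %% d) + b * (t %% d)) %% d)%N.
Proof. by rewrite -modnDm -(modnMmr a) -(modnMmr b) modnDm. Qed.

(** Twice a pentagonal number has the form 3 t^2 - t or 3 t^2 + t, and these
    are checked over the residues of t modulo 11. *)
Lemma f1_vanishes k :
  k \in [:: 3; 6; 8; 9; 10]%N -> vanishes 11 k f1.
Proof.
pose P a b m r := ((2 * m + a * r) %% 11 == (3 * r * r + b * r) %% 11)%N
                  ==> (m \notin [:: 3; 6; 8; 9; 10]%N).
move=> kin n nk; rewrite pentagonal coefD !qsum_supp ?addr0 // => t e; exfalso.
- have := @all_mod11 (P 0 1)%N n t.+1 isT; rewrite /P -modn_lin -modn_quad nk kin.
  apply/negP; rewrite implybF negbK; apply/eqP; congr (_ %% _)%N.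
  by have := bin2_sq t.+1; lia.
- have := @all_mod11 (P 1 0)%N n t isT; rewrite /P -modn_lin -modn_quad nk kin.
  apply/negP; rewrite implybF negbK; apply/eqP; congr (_ %% _)%N.
  by have := bin2_sq t; lia.
Qed.

(** The triangular numbers t(t+1)/2 in the class 4 are those with t = 5 modulo
    11, and there the weight 2t + 1 is divisible by 11. *)
Lemma f1_cube_vanishes (R : comNzRingType) k : 11 = 0 :> R ->
  k \in [:: 2; 4; 5; 7; 8; 9]%N -> vanishes 11 k (reduce R (f1 ^+ 3)).
Proof.
pose P m r := ((2 * m + 0 * r) %% 11 == (1 * r * r + 1 * r) %% 11)%N
              ==> (m \notin [:: 2; 4; 5; 7; 8; 9]%N) || (r == 5).
move=> R11 kin n nk; rewrite jacobi_cube /reduce /qsum rmorph_sum /=.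
rewrite big1 // => t /eqP e; rewrite rmorphM rmorph_nat.
suff -> : (2 * t + 1)%N%:R = 0 :> R by rewrite mulr0.
have := @all_mod11 P n t isT; rewrite /P -modn_lin -modn_quad nk kin /=.
have -> : (2 * n + 0 * t)%N = (1 * t * t + 1 * t)%N by have := bin2_sq t.+1; lia.
rewrite eqxx => /eqP t5; rewrite (divn_eq t 11) t5.
have -> : (2 * (t %/ 11 * 11 + 5) + 1 = (2 * (t %/ 11) + 1) * 11)%N by ring.
by rewrite natrM R11 mulr0.
Qed.

(** f2^2 = psi f1 and f1^2 = phi(-q) f2 turn psi^7 / phi(-q)^8 into f2^11 /
    (f1 phi(-q)^11). *)
Lemma coef_mod11 (W : series int) n : 8 * phim * W = 1 - phim ^+ 4 ->
  (W (88 * n + 55)%N = 0 %[mod 11])%Z.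
Proof.
move=> WE; pose R := 'F_11; have pR : 11%N \in [pchar R] by apply: pchar_Fp.
have R11 : 11 = 0 :> R by apply/val_inj.
set W87 := sec 2 1 (sec 4 3 W).
have f0 := reduce_0 R f1_0; have g0 := reduce_0 R f2_0; have y0 := reduce_0 R phim_0.
pose J := reduce R (f1 ^+ 3).
have JE : J = reduce R f1 ^+ 3 by exact: reduceX.
have tp (f : series R) k : theta (f ^+ (11 * k)) = 0.
  by apply: (theta_pow pR); apply: dvdn_mulr.
have v7 : vanishes 11 6 (J ^+ 7).
  apply: seventh_power_mod11 => // k kin; first exact: f1_cube_vanishes.
  have -> : J ^+ 4 = reduce R f1 ^+ (11 * 1) * reduce R f1 by rewrite JE; ring.
  apply: (vanishes_mul pR); first exact: tp.
  by move=> m mk; rewrite /reduce (f1_vanishes kin mk).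
have E : W87 * phim ^+ 11 * f1 ^+ 22 = 8 * f2 ^+ 11 * (f1 ^+ 3) ^+ 7.
  apply: (series_mulI (coef0X 6 f1_0)).
  have e1 : psi * f1 = f2 ^+ 2 by rewrite psiE -[in RHS]E1_f1 -E1_f1; ring.
  have e2 : phim * f2 = f1 ^+ 2 by rewrite [in RHS]f1_split phimE; ring.
  transitivity (W87 * phim ^+ 8 * phim ^+ 3 * f1 ^+ 28); first by ring.
  rewrite (sec_W87 WE).
  transitivity (8 * (psi * f1) ^+ 7 * phim ^+ 3 * f1 ^+ 21); first by ring.
  rewrite e1; transitivity (8 * f2 ^+ 11 * (phim * f2) ^+ 3 * f1 ^+ 21); first by ring.
  by rewrite e2; ring.
have v : vanishes 11 6 (reduce R W87).
  have th : theta (reduce R phim ^+ 11 * reduce R f1 ^+ 22) = 0.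
    by rewrite thetaM (tp _ 1%N) (tp _ 2) mul0r mulr0 addr0.
  apply: (vanishes_cancel pR (coef0M (coef0X 11 y0) (coef0X 22 f0)) th).
  have -> : reduce R phim ^+ 11 * reduce R f1 ^+ 22 * reduce R W87
      = reduce R f2 ^+ (11 * 1) * (J ^+ 7 *+ 8).
    have := congr1 (reduce R) E; rewrite 2!reduceM (reduceX _ phim) (reduceX _ f1).
    rewrite 2!reduceM (reduceX _ f2) reduceX reduce_nat -/J => e.
    transitivity (reduce R W87 * reduce R phim ^+ 11 * reduce R f1 ^+ 22); first by ring.
    by rewrite e; ring.
  apply: (vanishes_mul pR); first exact: tp.
  by move=> m m6; rewrite coefMn v7 ?mul0rn.
apply/eqP; rewrite eqz_mod_dvd subr0 (dvdz_pcharf pR).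
have n6 : ((11 * n + 6) %% 11 = 6)%N by rewrite mulnC modnMDl.
have := v _ n6; rewrite /reduce /W87 /sec => e; apply/eqP.
by rewrite -[RHS]e; congr (W _)%:~R; lia.
Qed.

Local Close Scope ring_scope.

Theorem theorem1p2 (n : nat) :
  [/\ (OSOME (24 * n + 19)%N = 0 %[mod 3])%Z,
      (OSOME (40 * n + 27)%N = 0 %[mod 5])%Z,
      (OSOME (8 * n + 7)%N = 0 %[mod 8])%Z
    & (OSOME (88 * n + 55)%N = 0 %[mod 11])%Z].
Proof.
split.
- exact: (coef_mod3 OSOME_four_squares).
- exact: (coef_mod5 OSOME_four_squares).
- exact: (coef_mod8 OSOME_four_squares).
- exact: (coef_mod11 _ OSOME_four_squares).
Qed.
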